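(* Let $N\ge3$, let $\lambda_1,\dots,\lambda_N>0$ with $\sum_{i=1}^N\lambda_i=1$, let $S,Y\subseteq\mathbb R^n$ be compact, let $\Omega=\overline{\operatorname{conv}(S\cup Y)}$, let $U\supseteq\Omega$ be open, and let $F\in C^2(U)$ satisfy, as quadratic forms on $U$, $-\tau_FI\le D^2F\le(1-\kappa_F)I$ for some constants $\kappa_F\in(0,1]$, $\tau_F\ge0$. Let $\rho\in\mathcal P_{\mathrm{ac}}(S)$, $\mu_2,\dots,\mu_N\in\mathcal P(Y)$, and $$c_F(x_1,\dots,x_N)=\inf_{y\in\mathbb R^n}\sum_{i=1}^N\frac{\lambda_i}2|x_i-y|^2+F\Big(\sum_{i=1}^N\lambda_ix_i\Big).$$ Let $(T_2^F,\dots,T_N^F)$ be the multi-marginal optimal transport maps for the cost $c_F$ associated with $(\rho,\mu_2,\dots,\mu_N)$, let $(\varphi_1^F,\dots,\varphi_N^F)$ be a $c_F$-conjugate tuple of Kantorovich potentials for this problem, and let $R_F:=c_F-\sum_{i=1}^N\varphi_i^F(x_i)$. Then, for $\rho$-a.e. $x_1\in S$ and every $x_2,\dots,x_N\in Y$, $$R_F(x_1,\dots,x_N)\ge\frac{\kappa_F}{4}\sum_{i=2}^N\lambda_i^2|V_{i,x}-V_i^F(x_1)|^2-\frac{1+\tau_F+2\kappa_F}{2}|Z_x-Z^F(x_1)|^2.$$ Moreover, let $\tilde\mu_2,\dots,\tilde\mu_N\in\mathcal P(Y)$ be another tuple of target marginals, let $(\tilde T_2^F,\dots,\tilde T_N^F)$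 be the corresponding multi-marginal optimal transport maps for the cost $c_F$ associated with $(\rho,\tilde\mu_2,\dots,\tilde\mu_N)$, and let $\tilde Z^F(x_1)=\lambda_1x_1+\sum_{i=2}^N\lambda_i\tilde T_i^F(x_1)$. Then $$\sum_{i=2}^N\lambda_i\|T_i^F-\tilde T_i^F\|_{L^2(\rho)}\le C\left[\Big(\sum_{i=2}^N\lambda_iW_1(\mu_i,\tilde\mu_i)\Big)^{1/2}+\|Z^F-\tilde Z^F\|_{L^2(\rho)}\right],$$ where $C$ depends only on $N$, $\operatorname{diam}(S\cup Y)$, $\kappa_F$ and $\tau_F$.
   Context: $\mathcal P(E)$ is the set of Borel probability measures on $E$; $\mathcal P_{\mathrm{ac}}(S)$ is the set of probability measures on $S$ absolutely continuous with respect to Lebesgue measure. $W_1$ is the 1-Wasserstein distance for the Euclidean distance. Multi-marginal optimal transport maps for the cost $c_F$: the ($\rho$-a.e. unique; existence and uniqueness follow from a theorem of Kim and Pass) minimizers of $\int_Sc_F(x_1,T_2(x_1),\dots,T_N(x_1))\,d\rho(x_1)$ among maps $T_i:S\to Y$ with $(T_i)_\#\rho=\mu_i$, $i=2,\dots,N$. A $c_F$-conjugate tuple of Kantorovich potentials: functions $\varphi_1^F$ on $S$ and $\varphi_i^F$ on $Y$ ($i\ge2$) maximizing $\int\varphi_1\,d\rho+\sum_{i\ge2}\int\varphi_i\,d\mu_i$ subject to $\sum_{i=1}^N\varphi_i(x_i)\le c_F(x_1,\dots,x_N)$ on $S\times Y^{N-1}$, and such that for each $i$, $\varphi_i^F(x_i)=\inf\{c_F(x_1,\dots,x_N)-\sum_{j\ne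 i}\varphi_j^F(x_j)\}$, the infimum being over the other variables. Thus $R_F\ge0$ on $S\times Y^{N-1}$, and by duality $R_F(x_1,T_2^F(x_1),\dots,T_N^F(x_1))=0$ for $\rho$-a.e. $x_1$. Notation: for $(x_1,\dots,x_N)\in S\times Y^{N-1}$, $Z_x=\sum_{i=1}^N\lambda_ix_i$, $M_x=\frac{Z_x-\lambda_1x_1}{1-\lambda_1}$, $V_{i,x}=x_i-M_x$ for $i=2,\dots,N$. For $x_1\in S$, $Z^F(x_1)=\lambda_1x_1+\sum_{i=2}^N\lambda_iT_i^F(x_1)$, $M^F(x_1)=\frac{Z^F(x_1)-\lambda_1x_1}{1-\lambda_1}$, $V_i^F(x_1)=T_i^F(x_1)-M^F(x_1)$ for $i=2,\dots,N$. *)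

(* Defs.v *)
From HB Require Import structures.
From mathcomp Require Import all_boot all_order all_algebra.
From mathcomp Require Import all_classical all_reals all_analysis.

Set Implicit Arguments.
Unset Strict Implicit.
Unset Printing Implicit Defensive.

Import Order.TTheory GRing.Theory Num.Theory.
Import numFieldNormedType.Exports.

Local Open Scope classical_set_scope.
Local Open Scope ring_scope.

(* Borel sigma-algebra. *)
HB.instance Definition _ (R : realType) (m n : nat) :=
  @isMeasurable.Build (sigma_display (@open 'M[R]_(m, n))) 'M[R]_(m, n)
    <<s open >> (@sigma_algebra0 _ setT open) (@sigma_algebraC _ open)
    (@sigma_algebra_bigcup _ setT open).

(* The library's norm on 'rV[R]_n is the sup norm; it induces the same topology
   (hence the same compact, open and Borel sets) as the Euclidean norm. *)
Definition enorm (R : realType) (n : nat) (x : 'rV[R]_n) : R :=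
  Num.sqrt (\sum_(i < n) x 0 i ^+ 2).

Definition ediam (R : realType) (n : nat) (A : set 'rV[R]_n) : R :=
  sup [set enorm (x - y) | x in A & y in A].

(* Lebesgue measure on R^n: iterated product of the one-dimensional Lebesgue
   measure, transported along (t, v) |-> (t, v_1, ..., v_n). *)
Fixpoint lebesgue_rV (R : realType) (n : nat) : set 'rV[R]_n -> \bar R :=
  match n with
  | 0 => \d_(0 : 'rV[R]_0)
  | k.+1 => pushforward (@lebesgue_measure R \x lebesgue_rV (n := k))%E
              (fun p : R * 'rV[R]_k => row_mx (p.1)%:M p.2 : 'rV[R]_k.+1)
  end.

Definition convex_hull (R : realType) (n : nat) (A : set 'rV[R]_n)
  : set 'rV[R]_n := smallest (@convex_set R 'rV[R]_n) A.

Section C2.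
Context {R : realType} {n : nat}.
Implicit Types (F : 'rV[R]_n -> R) (U : set 'rV[R]_n).

Definition partial (i : 'I_n) F : 'rV[R]_n -> R := 'D_(delta_mx 0 i) F.

Definition C2_on U F : Prop :=
  [/\ forall x, U x -> {for x, continuous F},
      forall (i : 'I_n) x, U x -> derivable F x (delta_mx 0 i) /\
        {for x, continuous (partial i F)}
    & forall (i j : 'I_n) x, U x -> derivable (partial i F) x (delta_mx 0 j) /\
        {for x, continuous (partial j (partial i F))}].

Definition hessian F (x : 'rV[R]_n) : 'M[R]_n :=
  \matrix_(i, j) partial j (partial i F) x.

Definition hessian_between U F (a b : R) : Prop :=
  forall x (v : 'rV[R]_n), U x ->
    a * enorm v ^+ 2 <= (v *m hessian F x *m v^T) 0 0 <= b * enorm v ^+ 2.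

End C2.

(* The tuple (a, f_0, ..., f_{m-1}).  The N = m.+1 marginals are indexed by
   'I_m.+1, with ord0 for the first one; 'I_m indexes the remaining ones, the
   index j : 'I_m standing for lift ord0 j : 'I_m.+1. *)
Definition fcons {A : Type} {m : nat} (a : A) (f : 'I_m -> A) : 'I_m.+1 -> A :=
  fun i => oapp f a (unlift ord0 i).

Section Barycenter.
Context {R : realType} {n m : nat}.
Implicit Types (lam : 'I_m.+1 -> R) (x : 'I_m.+1 -> 'rV[R]_n).

Definition baryZ lam x : 'rV[R]_n := \sum_i lam i *: x i.

Definition baryM lam x : 'rV[R]_n :=
  (1 - lam ord0)^-1 *: (baryZ lam x - lam ord0 *: x ord0).

Definition baryV lam x (i : 'I_m.+1) : 'rV[R]_n := x i - baryM lam x.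

Definition cost lam (F : 'rV[R]_n -> R) x : R :=
  inf [set \sum_i lam i / 2 * enorm (x i - y) ^+ 2 | y in [set: 'rV[R]_n]]
  + F (baryZ lam x).

(* The tuple (x1, T_2(x1), ..., T_N(x1)). *)
Definition transport_tuple (T : 'I_m -> 'rV[R]_n -> 'rV[R]_n) (x1 : 'rV[R]_n)
  : 'I_m.+1 -> 'rV[R]_n := fcons x1 (fun j => T j x1).

End Barycenter.

Section Monge.
Context {R : realType} {n m : nat}.
Variables (c : ('I_m.+1 -> 'rV[R]_n) -> R) (S Y : set 'rV[R]_n).
Variables (rho : probability 'rV[R]_n R) (mu : 'I_m -> probability 'rV[R]_n R).
Implicit Types T : 'I_m -> 'rV[R]_n -> 'rV[R]_n.

(* Only the values of T_j on S matter; rho is carried by S. *)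
Definition transport_maps T : Prop :=
  forall j, [/\ measurable_fun S (T j),
                forall x, S x -> Y (T j x)
              & forall A, measurable A -> rho (S `&` T j @^-1` A) = mu j A].

Definition monge_cost T : \bar R :=
  (\int[rho]_(x in S) (c (transport_tuple T x))%:E)%E.

Definition optimal_maps T : Prop :=
  transport_maps T /\
  forall T', transport_maps T' -> (monge_cost T <= monge_cost T')%E.

End Monge.

Section Kantorovich.
Context {R : realType} {n k : nat}.
Variables (c : ('I_k -> 'rV[R]_n) -> R) (D : 'I_k -> set 'rV[R]_n).
Variable nu : 'I_k -> probability 'rV[R]_n R.
Implicit Types phi : 'I_k -> 'rV[R]_n -> R.

Definition dual_admissible phi : Prop :=
  (forall i, (nu i).-integrable (D i) (EFin \o phi i)) /\
  (forall x, (forall i, D i (x i)) -> \sum_i phi i (x i) <= c x).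

Definition dual_value phi : \bar R :=
  (\sum_(i < k) \int[nu i]_(x in D i) (phi i x)%:E)%E.

Definition c_conjugate phi : Prop :=
  forall i (xi : 'rV[R]_n), D i xi ->
    ((phi i xi)%:E = ereal_inf
      [set (c x - \sum_(j < k | j != i) phi j (x j))%:E
      | x in [set x : 'I_k -> 'rV[R]_n
             | (forall j, D j (x j)) /\ x i = xi]])%E.

Definition conjugate_potentials phi : Prop :=
  [/\ dual_admissible phi,
      forall psi, dual_admissible psi -> (dual_value psi <= dual_value phi)%E
    & c_conjugate phi].

Definition residual phi (x : 'I_k -> 'rV[R]_n) : R :=
  c x - \sum_i phi i (x i).

End Kantorovich.

Section Distances.
Context {R : realType} {n : nat}.

Definition couplings (mu nu : probability 'rV[R]_n R)
  : set (probability ('rV[R]_n * 'rV[R]_n)%type R) :=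
  [set p | forall A, measurable A ->
     p (A `*` setT) = mu A /\ p (setT `*` A) = nu A].

Definition W1 (mu nu : probability 'rV[R]_n R) : \bar R :=
  ereal_inf [set (\int[p]_z (enorm (z.1 - z.2))%:E)%E | p in couplings mu nu].

Definition L2norm (rho : probability 'rV[R]_n R) (S : set 'rV[R]_n)
    (g : 'rV[R]_n -> 'rV[R]_n) : \bar R :=
  ('N[rho]_2%:E [(fun x => (enorm (g x))%:E) \_ S])%E.

End Distances.

(* Main.v *)
From HB Require Import structures.
Require Import Defs.
From mathcomp Require Import finmap.
From mathcomp Require Import all_boot all_order all_algebra.
From mathcomp Require Import all_classical all_reals all_analysis.
From mathcomp Require Import measurable_realfun.
From mathcomp Require Import ring lra.

(** Put G(z) = |z|^2 / 2 - F(z). Minimising over y gives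
    c_F(x) = sum_i lambda_i |x_i|^2 / 2 - G(Z_x), and the Hessian bounds say
    that on the convex hull of S and Y the function G lies between its tangent
    quadratics of curvature kappa and 1 + tau [C2_quad_bounds]. The proof uses
    F only through these two facts and the continuity of its gradient.

    The inequality. Let x and x' have the same first entry, let R(x') = 0 and
    put Z = Z_x, Z' = Z_x', u_i = lambda_i (x_i - x'_i). Write R >= 0 at each of
    the N - 1 tuples obtained from x' by replacing one entry x'_i by x_i, and
    add. The potentials and the separable part of the cost cancel, and
      R(x) >= sum_i (G(Z' + u_i) - G(Z')) - (G(Z) - G(Z')).
    As the u_i add up to Z - Z', the gradient terms at Z' cancel as well and
      R(x) >= kappa/2 sum_i |u_i|^2 - (1 + tau)/2 |Z - Z'|^2
    [residual_ge_swaps]. Passing from u_i to the centred vectors V_i costs half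
    of the first term and kappa |Z - Z'|^2 / 2 [centered_le].

    Optimal maps live on the contact set: R(x_1, T(x_1)) = 0 almost everywhere.
    If x and y are contact tuples, exchanging their first entries gives
    (y_1 - x_1).(grad G(Z_y) - grad G(Z_x)) >= 0 [contact_monotone]. So on a line
    parallel to the i-th axis there is at most one point x_1 with two contact
    tuples whose i-th components of grad G(Z) are separated by given values
    q < q'. By Fubini such x_1 form a Lebesgue-null set, and outside countably
    many of these sets grad G(Z), hence Z, hence (by the inequality) the whole
    contact tuple is a function T* of x_1 [contact_unique_ae]. Dual optimality
    makes T* transport rho to the mu_j: adding e on a closed set C to the j-th
    potential, and subtracting e from the first one on the points x_1 that see C
    with residual at most e, is an admissible perturbation, which yields
    mu_j(C) <= rho(T*_j in C) as e tends to 0 [contact_slice0_le]. As T* has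
    cost equal to the dual value and T is optimal, the nonnegative residual of T
    has integral 0 [optimal_residual0].

    Stability. Conjugate potentials exist, by compactness of families of
    uniformly Lipschitz functions [conjugate_potentials_exist]. Let phi and phi'
    be potentials for (mu_j) and (mu'_j). Integrating the residual of phi along
    T' and that of phi' along T, one gets
      int R_phi(T') + int R_phi'(T) = sum_j int (phi_j - phi'_j) d(mu_j - mu'_j).
    The difference phi_j - phi'_j is Lipschitz with constant lambda_j times a
    constant depending on tau and the diameter only [potentials_diff_lip]: the
    size of grad F disappears in the difference and what is left is a mixed
    second difference of G. So the right-hand side is at most that constant times
    sum_j lambda_j W_1(mu_j, mu'_j), while the left-hand side dominates the
    integrated inequality [stability_squares]. *)

Import Order.TTheory GRing.Theory Num.Theory.
Import numFieldNormedType.Exports.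
Set Implicit Arguments.
Unset Strict Implicit.
Unset Printing Implicit Defensive.
Local Open Scope classical_set_scope.
Local Open Scope ring_scope.

(** * Euclidean inner product *)

Section Euclid.
Context {R : realType} {n : nat}.
Implicit Types u v w : 'rV[R]_n.

Definition dot u v : R := \sum_i u 0 i * v 0 i.

Lemma dotC u v : dot u v = dot v u.
Proof. by apply: eq_bigr => i _; rewrite mulrC. Qed.

Lemma dotDl u v w : dot (u + v) w = dot u w + dot v w.
Proof. by rewrite -big_split; apply: eq_bigr => i _; rewrite mxE mulrDl. Qed.

Lemma dotDr u v w : dot w (u + v) = dot w u + dot w v.
Proof. by rewrite dotC dotDl !(dotC w). Qed.

Lemma dotZl a u v : dot (a *: u) v = a * dot u v.
Proof. by rewrite mulr_sumr; apply: eq_bigr => i _; rewrite mxE mulrA. Qed.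

Lemma dotZr a u v : dot u (a *: v) = a * dot u v.
Proof. by rewrite dotC dotZl dotC. Qed.

Lemma dotNl u v : dot (- u) v = - dot u v.
Proof. by rewrite -scaleN1r dotZl mulN1r. Qed.

Lemma dotNr u v : dot u (- v) = - dot u v.
Proof. by rewrite dotC dotNl dotC. Qed.

Definition dotE := (dotDl, dotDr, dotNl, dotNr, dotZl, dotZr).

Lemma dot0l u : dot 0 u = 0.
Proof. by rewrite -(scale0r u) dotZl mul0r. Qed.

Lemma dot_suml (I : Type) (r : seq I) (P : pred I) (f : I -> 'rV[R]_n) v :
  dot (\sum_(i <- r | P i) f i) v = \sum_(i <- r | P i) dot (f i) v.
Proof.
elim/big_rec2 : _ => [|i a b _ <-]; first by rewrite dot0l.
by rewrite dotDl.
Qed.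

Lemma dot_sumr (I : Type) (r : seq I) (P : pred I) (f : I -> 'rV[R]_n) v :
  dot v (\sum_(i <- r | P i) f i) = \sum_(i <- r | P i) dot v (f i).
Proof. by rewrite dotC dot_suml; apply: eq_bigr => i _; rewrite dotC. Qed.

Lemma dot_ge0 u : 0 <= dot u u.
Proof. by apply: sumr_ge0 => i _; rewrite -expr2 sqr_ge0. Qed.

Lemma dot_eq0 u : (dot u u == 0) = (u == 0).
Proof.
apply/idP/eqP => [|->]; last by rewrite dot0l.
rewrite psumr_eq0; last by move=> i _; rewrite -expr2 sqr_ge0.
move=> /allP h; apply/matrixP => i j; rewrite (ord1 i) mxE.
by have := h j (mem_index_enum j); rewrite /= -expr2 sqrf_eq0 => /eqP.
Qed.

Lemma enormE u : enorm u = Num.sqrt (dot u u).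
Proof. by rewrite /enorm; congr Num.sqrt; apply: eq_bigr => i _; rewrite expr2. Qed.

Lemma enorm_ge0 u : 0 <= enorm u.
Proof. exact: sqrtr_ge0. Qed.

Lemma sqr_enorm u : enorm u ^+ 2 = dot u u.
Proof. by rewrite enormE sqr_sqrtr// dot_ge0. Qed.

Lemma enorm_gt0 u : (0 < enorm u) = (u != 0).
Proof. by rewrite lt_neqAle enorm_ge0 andbT eq_sym -sqrf_eq0 sqr_enorm dot_eq0. Qed.

Lemma enormZ a u : enorm (a *: u) = `|a| * enorm u.
Proof.
by rewrite !enormE dotZl dotZr mulrA -expr2 sqrtrM ?sqr_ge0// sqrtr_sqr.
Qed.

Lemma enormN u : enorm (- u) = enorm u.
Proof. by rewrite !enormE dotNl dotNr opprK. Qed.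

Lemma dot_le_enorm u v : dot u v <= enorm u * enorm v.
Proof.
have [->|v0] := eqVneq v 0.
  by rewrite dotC dot0l mulr_ge0// enorm_ge0.
have vv : 0 < dot v v by rewrite lt_neqAle dot_ge0 eq_sym dot_eq0 v0.
have [uv0|uv0] := leP (dot u v) 0.
  by rewrite (le_trans uv0)// mulr_ge0// enorm_ge0.
rewrite -(@ler_pXn2r _ 2)// ?nnegrE ?mulr_ge0 ?enorm_ge0 ?(ltW uv0)//.
rewrite exprMn !sqr_enorm.
have := dot_ge0 (dot v v *: u - dot u v *: v).
rewrite !dotE (dotC v u) => h.
have {}h : 0 <= dot v v * (dot u u * dot v v - dot u v ^+ 2) by nra.
by move: h; rewrite pmulr_rge0// subr_ge0.
Qed.

Lemma enormD u v : enorm (u + v) <= enorm u + enorm v.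
Proof.
rewrite -(@ler_pXn2r _ 2)// ?nnegrE ?addr_ge0 ?enorm_ge0//.
rewrite sqrrD !sqr_enorm !dotE (dotC v u).
have := dot_le_enorm u v; lra.
Qed.

End Euclid.

(** * Quadratic bounds and the exchange inequality *)

Section SwapInequality.
Context {R : realType} {n m : nat}.
Implicit Types (G : 'rV[R]_n -> R) (g : 'rV[R]_n -> 'rV[R]_n).

(** Two-sided comparison with quadratics; [g] stands for the gradient of [G].
    It replaces second derivatives from here on. *)
Definition quad_bounds G g (Om : set 'rV[R]_n) (k b : R) :=
  forall u v, Om u -> Om v ->
    G u + dot (g u) (v - u) + k / 2 * dot (v - u) (v - u) <= G v
    <= G u + dot (g u) (v - u) + b / 2 * dot (v - u) (v - u).

Definition upd (x : 'I_m.+1 -> 'rV[R]_n) i v : 'I_m.+1 -> 'rV[R]_n :=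
  fun l => if l == i then v else x l.

Lemma sum_upd (V : zmodType) (f : 'I_m.+1 -> 'rV[R]_n -> V) x i v :
  \sum_l f l (upd x i v l) = \sum_l f l (x l) + (f i v - f i (x i)).
Proof.
rewrite (bigD1 i)//= [in RHS](bigD1 i)//= /upd eqxx.
under eq_bigr => l /negbTE -> do [].
by rewrite addrC [f i (x i) + _]addrC -addrA [f i (x i) + _]addrC subrK.
Qed.

Lemma baryZ_upd lam x i v :
  baryZ lam (upd x i v) = baryZ lam x + lam i *: (v - x i).
Proof. by rewrite /baryZ (sum_upd (fun l y => lam l *: y)) scalerBr. Qed.

(** Sum the admissibility of [phi] over the tuples that take one entry from [x]
    and all the others from [x']. Both potentials and separable cost terms
    cancel against those of [x] and [x'], leaving increments of [G] at
    [baryZ lam x']; their gradient parts cancel because the increments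
    [lam i *: (x i - x' i)] add up to the difference of the barycenters. *)
Lemma residual_ge_swaps lam G g (D : 'I_m.+1 -> set 'rV[R]_n) (Om : set 'rV[R]_n) (k b : R)
    (c : ('I_m.+1 -> 'rV[R]_n) -> R) phi x x' :
  (forall x, c x = \sum_i lam i / 2 * dot (x i) (x i) - G (baryZ lam x)) ->
  (forall x, (forall i, D i (x i)) -> Om (baryZ lam x)) ->
  quad_bounds G g Om k b ->
  (forall x, (forall i, D i (x i)) -> \sum_i phi i (x i) <= c x) ->
  (forall i, D i (x i)) -> (forall i, D i (x' i)) -> x ord0 = x' ord0 ->
  residual c phi x' = 0 ->
  k / 2 * \sum_(j < m) dot (lam (lift ord0 j) *: (x (lift ord0 j) - x' (lift ord0 j)))
                           (lam (lift ord0 j) *: (x (lift ord0 j) - x' (lift ord0 j)))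
  - b / 2 * dot (baryZ lam x - baryZ lam x') (baryZ lam x - baryZ lam x')
  <= residual c phi x.
Proof.
move=> cE DOm qb adm Dx Dx' x0 r0.
pose u j := lam (lift ord0 j) *: (x (lift ord0 j) - x' (lift ord0 j)).
pose y j := upd x' (lift ord0 j) (x (lift ord0 j)).
have Dy j i : D i (y j i) by rewrite /y /upd; case: eqP => [->|_].
have Zy j : baryZ lam (y j) = baryZ lam x' + u j by rewrite baryZ_upd.
have ZD : baryZ lam x - baryZ lam x' = \sum_j u j.
  rewrite /baryZ -sumrB big_ord_recl x0 subrr add0r.
  by apply: eq_bigr => j _; rewrite /u scalerBr.
set Z' := baryZ lam x' in Zy ZD *; set Z := baryZ lam x in ZD *.
have sE j : residual c phi (y j) = residual c phi x' - (G (Z' + u j) - G Z')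
   + (lam (lift ord0 j) / 2 * dot (x (lift ord0 j)) (x (lift ord0 j))
      - phi (lift ord0 j) (x (lift ord0 j)))
   - (lam (lift ord0 j) / 2 * dot (x' (lift ord0 j)) (x' (lift ord0 j))
      - phi (lift ord0 j) (x' (lift ord0 j))).
  rewrite /residual !cE Zy /y (sum_upd (fun l y => lam l / 2 * dot y y)).
  rewrite (sum_upd phi) -/Z'; lra.
have tE : residual c phi x = residual c phi x' - (G Z - G Z') + \sum_j
   ((lam (lift ord0 j) / 2 * dot (x (lift ord0 j)) (x (lift ord0 j))
      - phi (lift ord0 j) (x (lift ord0 j)))
   - (lam (lift ord0 j) / 2 * dot (x' (lift ord0 j)) (x' (lift ord0 j))
      - phi (lift ord0 j) (x' (lift ord0 j)))).
  rewrite /residual !cE -/Z -/Z' !big_ord_recl x0 !sumrB; lra.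
have key : \sum_j (G (Z' + u j) - G Z') - (G Z - G Z') <= residual c phi x.
  rewrite tE r0 add0r addrC lerD2l -subr_ge0 -sumrB.
  apply: sumr_ge0 => j _.
  have : 0 <= residual c phi (y j) by rewrite subr_ge0 adm.
  by rewrite sE r0; lra.
apply: le_trans key.
have OmZ : Om Z by apply: DOm.
have OmZ' : Om Z' by apply: DOm.
have lo : \sum_j (dot (g Z') (u j) + k / 2 * dot (u j) (u j))
    <= \sum_j (G (Z' + u j) - G Z').
  apply: ler_sum => j _.
  have := qb Z' (Z' + u j) OmZ' _.
  rewrite -{1}Zy => /(_ (DOm _ (Dy j)))/andP[+ _].
  by rewrite [Z' + _]addrC addrK; lra.
have := qb Z' Z OmZ' OmZ => /andP[_]; move: lo.
rewrite big_split /= -dot_sumr -mulr_sumr ZD -/u; lra.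
Qed.

End SwapInequality.

(** * Calculus along lines *)

Section Lines.
Context {R : realType} {n : nat}.
Implicit Types (f : 'rV[R]_n -> R) (x v w e : 'rV[R]_n).

Lemma is_derive_line f a v t : derivable f (a + t *: v) v ->
  is_derive t 1 (fun s : R => f (a + s *: v)) ('D_v f (a + t *: v)).
Proof.
have E : (fun h : R => h^-1 *: (((fun s => f (a + s *: v)) \o shift t) (h *: (1 : R))
            - f (a + t *: v))) =
         (fun h : R => h^-1 *: ((f \o shift (a + t *: v)) (h *: v) - f (a + t *: v))).
  apply/funext => h /=; congr (_ *: (f _ - _)).
  by rewrite -[h *: 1]/(h * 1) mulr1 scalerDl addrCA.
by move=> df; split; rewrite /derivable /derive E.
Qed.

(** Absolute values on [s] and [t] let one statement serve both sides of [a]. *)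
Lemma MVT_line f a v t :
  (forall s, `|s| <= `|t| -> derivable f (a + s *: v) v) ->
  exists2 s, `|s| <= `|t| & f (a + t *: v) - f a = 'D_v f (a + s *: v) * t.
Proof.
move=> df.
pose phi (s : R) := f (a + s *: v).
have cphi s : `|s| <= `|t| -> {for s, continuous phi}.
  move=> /df/is_derive_line[d _].
  by apply/differentiable_continuous/derivable1_diffP.
have f0 : f a = phi 0 by rewrite /phi scale0r addr0.
have [t0|t0] := leP 0 t.
- have [||s] := @MVT_segment _ phi (fun s => 'D_v f (a + s *: v)) 0 t t0.
  + move=> s; rewrite in_itv/= => /andP[s0 st]; apply/is_derive_line/df.
    by rewrite !ger0_norm// ltW.
  + apply: continuous_in_subspaceT => s; rewrite inE/= in_itv/= => /andP[s0 st].
    by apply: cphi; rewrite !ger0_norm.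
  + rewrite in_itv/= => /andP[s0 st]; rewrite subr0 f0 => h; exists s => //.
    by rewrite !ger0_norm.
- have [||s] := @MVT_segment _ phi (fun s => 'D_v f (a + s *: v)) t 0 (ltW t0).
  + move=> s; rewrite in_itv/= => /andP[s0 st]; apply/is_derive_line/df.
    by rewrite (ltr0_norm t0) ltr0_norm// lerN2 ltW.
  + apply: continuous_in_subspaceT => s; rewrite inE/= in_itv/= => /andP[s0 st].
    by apply: cphi; rewrite (ltr0_norm t0) ler0_norm// lerN2.
  + rewrite in_itv/= => /andP[s0 st]; rewrite f0 sub0r => h; exists s => //.
      by rewrite (ltr0_norm t0) ler0_norm// lerN2.
    by rewrite -[LHS]opprB h mulrN opprK.
Qed.

(** The increment along [w + b *: e] is split into a step along [w] and a step
    along [e]; the mean value theorem turns the latter into a value of the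
    derivative along [e] at a nearby point, which converges by continuity. *)
Lemma is_derive_dirD f x w e (b : R) :
  (\forall y \near x, derivable f y e) -> {for x, continuous ('D_e f)} ->
  derivable f x w ->
  is_derive x (w + b *: e) f ('D_w f x + b * 'D_e f x).
Proof.
move=> dfe ce dfw.
suff h : (fun h : R => h^-1 *: ((f \o shift x) (h *: (w + b *: e)) - f x)) @ 0^'
    --> 'D_w f x + b * 'D_e f x.
  by split; [apply/cvg_ex; eexists; exact: h | exact/cvg_lim].
have E h : h^-1 *: ((f \o shift x) (h *: (w + b *: e)) - f x) =
   h^-1 *: ((f \o shift x) (h *: w) - f x)
   + h^-1 *: (f (x + h *: w + (h * b) *: e) - f (x + h *: w)).
  rewrite -scalerDr /=; congr (_ *: _).
  rewrite [x + h *: w]addrC [X in _ = X]addrC addrA subrK; congr (f _ - _).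
  by rewrite scalerDr scalerA addrAC.
under eq_fun do rewrite E.
apply: cvgD; first exact: dfw.
apply/cvgrPdist_lt => eps eps0.
have b1 : 0 < `|b| + 1 by rewrite ltr_wpDl.
have /cvgrPdist_lt/(_ (eps / (`|b| + 1)) (divr_gt0 eps0 b1)) ce' := ce.
have : nbhs x [set y | derivable f y e /\
    `|'D_e f x - 'D_e f y| < eps / (`|b| + 1)].
  by apply: filterS2 dfe ce' => y.
move=> /nbhs_ballP[r /= r0 rP].
pose K := `|w| + `|b| * `|e| + 1.
have K0 : 0 < K by rewrite ltr_wpDl// addr_ge0// mulr_ge0.
rewrite /dnbhs nearE /within /=; apply/nbhs_ballP.
exists (r / K) => /=; first exact: divr_gt0.
move=> h; rewrite /ball/= sub0r normrN => hr h0.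
have inb s : `|s| <= `|h * b| -> ball x r (x + h *: w + s *: e).
  move=> sh; rewrite -ball_normE /= -addrA opprD addNKr normrN.
  apply: le_lt_trans (ler_normD _ _) _; rewrite !normrZ.
  have : `|h| * K < r by rewrite -ltr_pdivlMr.
  apply: le_lt_trans; rewrite /K.
  have : `|s| * `|e| <= `|h| * `|b| * `|e| by rewrite ler_wpM2r// -normrM.
  have := normr_ge0 h; lra.
have [|s sh ->] := @MVT_line f (x + h *: w) e (h * b).
  by move=> s /inb/rP[].
have [_] := rP _ (inb s sh).
set d := 'D_e f x; set d' := 'D_e f _.
rewrite -[_ *: _]/(_ * _) => dd.
have -> : h^-1 * (d' * (h * b)) = b * d' by field.
rewrite -mulrBr normrM.
apply: (@le_lt_trans _ _ (`|b| * (eps / (`|b| + 1)))).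
  by rewrite ler_wpM2l// ltW.
rewrite mulrCA gtr_pMr// ltr_pdivrMr// mul1r ltrDl//.
Qed.

Lemma is_derive_dir0 f x : is_derive x 0 f 0.
Proof.
have E : (fun h : R => h^-1 *: ((f \o shift x) (h *: 0) - f x)) = cst 0.
  by apply/funext => h /=; rewrite scaler0 add0r subrr scaler0.
split; rewrite /derivable /derive E; last exact: lim_cst.
exact: is_cvg_cst.
Qed.

Definition grad f x : 'rV[R]_n := \row_i partial i f x.

(** Continuous partial derivatives give all directional derivatives: add the
    coordinate directions one at a time. *)
Lemma is_derive_partial f x v :
  (forall i, \forall y \near x, derivable f y (delta_mx 0 i)) ->
  (forall i, {for x, continuous (partial i f)}) ->
  is_derive x v f (dot (grad f x) v).
Proof.
move=> df cf.
rewrite {1}(row_sum_delta v) /dot.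
elim: (index_enum _) => [|i s IH]; first by rewrite !big_nil; exact: is_derive_dir0.
rewrite !big_cons !mxE addrC [X in is_derive _ _ _ X]addrC.
case: IH => dx <-; rewrite [partial i f x * _]mulrC.
exact: is_derive_dirD (df i) (cf i) dx.
Qed.

End Lines.

Section C2bounds.
Context {R : realType} {n : nat}.
Implicit Types (F : 'rV[R]_n -> R).

(** The mean value theorem is used twice: for [g1], then for [g] minus the quadratic
    that it is compared with. *)
Lemma taylor2_le (g g1 g2 : R -> R) (b : R) :
  (forall t : R, 0 <= t <= 1 -> is_derive t 1 g (g1 t)) ->
  (forall t : R, 0 <= t <= 1 -> is_derive t 1 g1 (g2 t)) ->
  (forall t : R, 0 <= t <= 1 -> g2 t <= b) ->
  g 1 <= g 0 + g1 0 + b / 2.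
Proof.
move=> dg dg1 g2b.
have cont (f df : R -> R) : (forall t : R, 0 <= t <= 1 -> is_derive t 1 f (df t)) ->
    forall a c, 0 <= a -> c <= 1 -> {within `[a, c], continuous f}.
  move=> h a c a0 c1; apply: continuous_in_subspaceT => s.
  rewrite inE/= in_itv/= => /andP[s0 st].
  have [d _] : is_derive s 1 f (df s) by apply: h; lra.
  by apply/differentiable_continuous/derivable1_diffP.
have h1 (t : R) : 0 <= t <= 1 -> g1 t <= g1 0 + b * t.
  move=> /andP[t0 t1].
  have [||s] := @MVT_segment _ g1 g2 0 t t0.
  - by move=> s; rewrite in_itv/= => /andP[? ?]; apply: dg1; lra.
  - exact: cont dg1 _ _ _ _.
  rewrite in_itv/= => /andP[s0 st] h.
  have : g2 s <= b by apply: g2b; lra.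
  nra.
pose k (t : R) := g t - g1 0 * t - b / 2 * t ^+ 2.
have dk (t : R) : 0 <= t <= 1 -> is_derive t 1 k (g1 t - g1 0 - b * t).
  move=> t01; have := dg t t01 => ?; rewrite /k.
  apply: is_derive_eq.
  by rewrite /GRing.scale /=; lra.
have [||s] := @MVT_segment _ k (fun t => g1 t - g1 0 - b * t) 0 1 ler01.
- by move=> s; rewrite in_itv/= => /andP[? ?]; apply: dk; lra.
- exact: cont dk _ _ _ _.
rewrite in_itv/= => /andP[s0 st]; rewrite /k.
have := h1 s; rewrite s0 st => /(_ isT); lra.
Qed.

Definition segment_in (U : set 'rV[R]_n) u v :=
  forall t : R, 0 <= t <= 1 -> U (u + t *: (v - u)).

(** Restrict [F] to the segment: its second derivative there is the Hessian form
    at the direction of the segment. *)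
Lemma C2_taylor U F (a b : R) u v : open U -> C2_on U F ->
  hessian_between U F a b -> segment_in U u v ->
  F u + dot (grad F u) (v - u) + a / 2 * dot (v - u) (v - u) <= F v
  <= F u + dot (grad F u) (v - u) + b / 2 * dot (v - u) (v - u).
Proof.
move=> oU [_ C1 C2] hess uv.
rewrite /segment_in in uv; set w := v - u in uv *.
have d1 x : U x -> is_derive x w F (dot (grad F x) w).
  move=> Ux; apply: is_derive_partial => i; last by have [] := C1 i x Ux.
  have : nbhs x U by exact: open_nbhs_nbhs.
  by apply: filterS => y /(C1 i)[].
have d2 i x : U x -> is_derive x w (partial i F) (dot (grad (partial i F) x) w).
  move=> Ux; apply: is_derive_partial => j; last by have [] := C2 i j x Ux.
  have : nbhs x U by exact: open_nbhs_nbhs.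
  by apply: filterS => y /(C2 i j)[].
pose g (t : R) := F (u + t *: w); pose g1 (t : R) := dot (grad F (u + t *: w)) w.
pose g2 (t : R) := (w *m hessian F (u + t *: w) *m w^T) 0 0.
have dg (t : R) : 0 <= t <= 1 -> is_derive t 1 g (g1 t).
  by move=> /uv /d1 [dF dE]; rewrite /g1 -dE; exact: is_derive_line.
have dg1 (t : R) : 0 <= t <= 1 -> is_derive t 1 g1 (g2 t).
  move=> /uv Ut.
  have -> : g1 = \sum_i (fun s => w 0 i * partial i F (u + s *: w)).
    apply/funext => s; rewrite fct_sumE; apply: eq_bigr => i _.
    by rewrite mxE mulrC.
  have -> : g2 t = \sum_i w 0 i * dot (grad (partial i F) (u + t *: w)) w.
    rewrite /g2 -mulmxA mxE; apply: eq_bigr => i _; congr (_ * _).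
    by rewrite mxE; apply: eq_bigr => j _; rewrite !mxE.
  have di i : is_derive t 1 (fun s => w 0 i * partial i F (u + s *: w))
      (w 0 i * dot (grad (partial i F) (u + t *: w)) w).
    have [dF dE] := d2 i _ Ut; rewrite -dE.
    by have := is_derive_line dF; exact: is_deriveZ.
  elim/big_rec2 : _ => [|i f df _ IH]; first exact: is_derive_cst.
  exact: is_deriveD.
have E0 : u + 0 *: w = u by rewrite scale0r addr0.
have E1 : u + 1 *: w = v by rewrite scale1r /w addrC subrK.
have hb (t : R) : 0 <= t <= 1 -> a * dot w w <= g2 t <= b * dot w w.
  by move=> /uv Ut; have := hess _ w Ut; rewrite !sqr_enorm.
have up := @taylor2_le g g1 g2 (b * dot w w) dg dg1.
have lo := @taylor2_le (- g) (- g1) (- g2) (- (a * dot w w)).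
move: up lo; rewrite /g /g1 /= !fctE E0 E1 => up lo.
apply/andP; split.
  have : - F v <= - F u + - dot (grad F u) w + - (a * dot w w) / 2.
    apply: lo => t t01.
    - by have := dg t t01; exact: is_deriveN.
    - by have := dg1 t t01; exact: is_deriveN.
    - by rewrite lerN2; have /andP[] := hb t t01.
  lra.
have := up _; have h (t : R) : 0 <= t <= 1 -> g2 t <= b * dot w w.
  by move=> /hb/andP[].
by move=> /(_ h); lra.
Qed.

End C2bounds.

(** * Convex hulls and functions with quadratic bounds *)

Section Convexity.
Context {R : realType} {n : nat}.
Implicit Types (A : set 'rV[R]_n) (u v : 'rV[R]_n).

Definition segment_closed A := forall u v, A u -> A v -> segment_in A u v.

Lemma convex_hull_segment_closed A : segment_closed (convex_hull A).
Proof.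
move=> u v Au Av t /andP[t0 t1] B [cB AB].
have Bu : (u : convex_lmodType 'rV[R]_n) \in (B : set (convex_lmodType _)).
  by rewrite inE; apply: Au.
have Bv : (v : convex_lmodType 'rV[R]_n) \in (B : set (convex_lmodType _)).
  by rewrite inE; apply: Av.
have := cB _ _ (Itv01 t0 t1) Bv Bu; rewrite inE; congr B.
rewrite /conv /= /unstable.onem scalerBl scale1r scalerBr.
exact: addrCA.
Qed.

Lemma sub_convex_hull A : A `<=` convex_hull A.
Proof. by move=> x Ax B [_]; apply. Qed.

Lemma segment_closed_sum A k (t : 'I_k.+1 -> R) (x : 'I_k.+1 -> 'rV[R]_n) :
  segment_closed A -> (forall i, 0 <= t i) -> \sum_i t i = 1 ->
  (forall i, A (x i)) -> A (\sum_i t i *: x i).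
Proof.
move=> cA; elim: k t x => [|k IH] t x t0 t1 Ax.
  by move: t1; rewrite !big_ord1 => ->; rewrite scale1r.
rewrite big_ord_recl /=; set s := \sum_i t (lift ord0 i).
have ts : t ord0 + s = 1 by rewrite -t1 big_ord_recl.
have s0 : 0 <= s by exact: sumr_ge0.
have [sz|sn] := eqVneq s 0.
  have tz i : t (lift ord0 i) = 0.
    apply/eqP; have /eqP := sz; rewrite psumr_eq0// => /allP /(_ i).
    by rewrite mem_index_enum => /(_ isT).
  rewrite big1 => [|i _]; last by rewrite tz scale0r.
  by move: ts; rewrite sz !addr0 => ->; rewrite scale1r.
have -> : t ord0 *: x ord0 + \sum_(i < k.+1) t (lift ord0 i) *: x (lift ord0 i) =
    x ord0 + s *: (\sum_i (t (lift ord0 i) / s) *: x (lift ord0 i) - x ord0).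
  have -> : t ord0 *: x ord0 = x ord0 - s *: x ord0.
    by rewrite -[x ord0 in X in X - _]scale1r -ts scalerDl addrK.
  rewrite scalerBr scaler_sumr -addrA [- _ + _]addrC; congr (_ + (_ - _)).
  by apply: eq_bigr => i _; rewrite scalerA mulrCA divff// mulr1.
apply: cA => //; last by rewrite s0 -ts lerDr t0.
apply: IH => // [i|]; first by rewrite divr_ge0.
by rewrite -mulr_suml divff.
Qed.

Lemma baryZ_segment_closed A m (lam : 'I_m.+1 -> R) x : segment_closed A ->
  (forall i, 0 < lam i) -> \sum_i lam i = 1 -> (forall i, A (x i)) -> A (baryZ lam x).
Proof.
by move=> cA l0 l1 Ax; apply: segment_closed_sum => // i; exact: ltW.
Qed.

Lemma C2_quad_bounds (U A : set 'rV[R]_n) F (kappa tau : R) :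
  open U -> segment_closed A -> A `<=` U -> C2_on U F ->
  hessian_between U F (- tau) (1 - kappa) ->
  quad_bounds (fun z => dot z z / 2 - F z) (fun z => z - grad F z) A kappa (1 + tau).
Proof.
move=> oU cA AU C2 hess u v Au Av.
have suv : segment_in U u v by move=> t /(cA u v Au Av)/AU.
have := C2_taylor oU C2 hess suv.
have -> : dot v v = dot u u + 2 * dot u (v - u) + dot (v - u) (v - u).
  by rewrite !dotE (dotC v u); ring.
rewrite dotDl dotNl; lra.
Qed.

Lemma quad_bounds_mono A G g (k b : R) u v : quad_bounds G g A k b -> A u -> A v ->
  k * dot (v - u) (v - u) <= dot (g v - g u) (v - u).
Proof.
move=> qb Au Av; have := qb u v Au Av; have := qb v u Av Au.
rewrite -opprB !dotE; lra.
Qed.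

Lemma quad_bounds_lip A G g (k b M : R) u v : 0 <= k -> quad_bounds G g A k b ->
  A u -> A v -> enorm (g u) <= M -> enorm (g v) <= M ->
  `|G u - G v| <= M * enorm (u - v).
Proof.
move=> k0 qb Au Av gu gv.
have := qb u v Au Av; have := qb v u Av Au.
have h : 0 <= k / 2 * dot (u - v) (u - v) by rewrite mulr_ge0 ?dot_ge0 ?divr_ge0.
have := dot_le_enorm (g u) (u - v).
have := dot_le_enorm (- g v) (u - v); rewrite enormN.
have := ler_wpM2r (enorm_ge0 (u - v)) gu; have := ler_wpM2r (enorm_ge0 (u - v)) gv.
move: h; rewrite -[v - u]opprB !dotE ler_norml; lra.
Qed.

(** The mixed second difference with steps [h] and [w] is at most b/4 |h + w|^2,
    since its four points are the ends of two segments with a common midpoint.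
    The translation from [x] to [y] is cut into about |y - x| / |h| steps [w],
    so that the total bound is linear in |h|. *)
Lemma mixed_difference A G g (k b d : R) x y h :
  0 <= k -> 0 <= b -> segment_closed A -> quad_bounds G g A k b ->
  A x -> A (x + h) -> A y -> A (y + h) -> enorm h <= d -> enorm (y - x) <= d ->
  (G (y + h) - G y) - (G (x + h) - G x) <= 5 / 4 * b * (enorm h * d).
Proof.
move=> k0 b0 cA qb Ax Axh Ay Ayh hd yd.
have step z w : A z -> A (z + h) -> A (z + w) -> A (z + w + h) ->
    (G (z + w + h) - G (z + w)) - (G (z + h) - G z) <= b / 4 * enorm (h + w) ^+ 2.
  move=> Az Azh Azw Azwh.
  (* The segments from z to z + w + h and from z + h to z + w share their
     midpoint z + e (h + w). *)
  pose e : R := 2^-1.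
  have Ap : A (z + e *: (h + w)).
    have := @cA _ _ Az Azwh e; rewrite (_ : z + w + h - z = h + w).
      by apply; rewrite /e; lra.
    by apply/rowP => i; rewrite !mxE; ring.
  have q1 := qb _ _ Ap Az; have q2 := qb _ _ Ap Azwh.
  have q3 := qb _ _ Ap Azh; have q4 := qb _ _ Ap Azw.
  move: q1 q2 q3 q4; set p := z + e *: (h + w).
  have E1 : z - p = - (e *: (h + w)) by rewrite /p opprD addrA subrr sub0r.
  have E2 : z + w + h - p = e *: (h + w).
    by apply/rowP => i; rewrite !mxE /e; field.
  have E3 : z + h - p = e *: (h - w).
    by apply/rowP => i; rewrite !mxE /e; field.
  have E4 : z + w - p = - (e *: (h - w)).
    by apply/rowP => i; rewrite !mxE /e; field.
  rewrite E1 E2 E3 E4 sqr_enorm !(dotNl, dotNr, dotZl, dotZr) ?opprK.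
  have := dot_ge0 (h - w).
  move: (dot (h - w) (h - w)) (dot (h + w) (h + w)) (dot (g p) _) (dot (g p) _).
  move=> a1 a2 a3 a4 a10.
  have : 0 <= k * a1 by rewrite mulr_ge0.
  rewrite /e; lra.
have [->|h0] := eqVneq h 0.
  by rewrite !addr0 !subrr mulr_ge0// ?mulr_ge0 ?enorm_ge0// (le_trans (enorm_ge0 _) hd).
have nh : 0 < enorm h by rewrite enorm_gt0.
(* The number of steps; each of them is at most as long as h. *)
pose w := y - x; pose L := (Num.truncn (enorm w / enorm h)).+1.
have L0 : 0 < (L%:R : R) by rewrite ltr0n.
have [L1 L2] : enorm w <= L%:R * enorm h /\ L%:R * enorm h <= enorm w + enorm h.
  have q0 : 0 <= enorm w / enorm h by rewrite divr_ge0 ?enorm_ge0.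
  have /andP[t1 t2] := truncn_itv q0; split.
    by rewrite -ler_pdivrMr// ltW.
  rewrite -ler_pdivlMr// mulrDl divff ?gt_eqF// /L -natr1 lerD2r.
  by [].
have Az (l : nat) : (l <= L)%N -> A (x + (l%:R / L%:R) *: w) /\ A (x + (l%:R / L%:R) *: w + h).
  move=> lL; have l01 : 0 <= (l%:R / L%:R : R) <= 1.
    by rewrite divr_ge0//= ler_pdivrMr// mul1r ler_nat.
  split; first exact: cA.
  have -> : x + (l%:R / L%:R) *: w + h = x + h + (l%:R / L%:R) *: (y + h - (x + h)).
    by apply/rowP => i; rewrite !mxE; ring.
  exact: cA.
have tel (l : nat) : (l <= L)%N ->
   (G (x + (l%:R / L%:R) *: w + h) - G (x + (l%:R / L%:R) *: w)) - (G (x + h) - G x)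
   <= l%:R * (b / 4 * enorm (h + L%:R^-1 *: w) ^+ 2).
  elim: l => [_|l IH lL]; first by rewrite !mul0r scale0r !addr0 subrr.
  have [A1 A2] := Az l (ltnW lL); have [A3 A4] := Az l.+1 lL.
  have E : x + (l.+1%:R / L%:R) *: w = x + (l%:R / L%:R) *: w + L%:R^-1 *: w.
    by rewrite -natr1 mulrDl mul1r scalerDl addrA.
  rewrite E in A3 A4 *.
  rewrite -(natr1 l) [leRHS]mulrDl mul1r.
  have := step _ _ A1 A2 A3 A4; have := IH (ltnW lL).
  lra.
have := tel L (leqnn _); rewrite divff ?gt_eqF// scale1r /w [x + _]addrC subrK -/w.
move=> /le_trans; apply.
have tri : enorm (h + L%:R^-1 *: w) <= enorm h + L%:R^-1 * enorm w.
  by rewrite (le_trans (enormD _ _))// enormZ ger0_norm ?invr_ge0.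
apply: (@le_trans _ _ (L%:R * (b / 4 * (enorm h + L%:R^-1 * enorm w) ^+ 2))).
  rewrite ler_pM2l// ler_wpM2l ?divr_ge0// ler_pXn2r ?nnegrE ?enorm_ge0//.
  by rewrite addr_ge0 ?mulr_ge0 ?enorm_ge0 ?invr_ge0.
have -> : L%:R * (b / 4 * (enorm h + L%:R^-1 * enorm w) ^+ 2) =
  b / 4 * (L%:R * enorm h * enorm h + 2 * enorm h * enorm w + enorm w * (enorm w / L%:R)).
  by field; rewrite gt_eqF.
have -> : 5 / 4 * b * (enorm h * d) = b / 4 * (5 * (enorm h * d)) by field.
rewrite ler_wpM2l ?divr_ge0//.
have : enorm w / L%:R <= enorm h by rewrite ler_pdivrMr// mulrC.
have := enorm_ge0 w; rewrite -/w in yd; nra.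
Qed.

End Convexity.

(** * The cost in terms of the barycenter *)

Section CostFormula.
Context {R : realType} {n m : nat}.

(** The infimum over [y] is attained at the barycenter (sum of squares). *)
Lemma cost_quadratic (lam : 'I_m.+1 -> R) (F : 'rV[R]_n -> R) x :
  \sum_i lam i = 1 ->
  cost lam F x = \sum_i lam i / 2 * dot (x i) (x i)
    - (dot (baryZ lam x) (baryZ lam x) / 2 - F (baryZ lam x)).
Proof.
move=> l1; rewrite /cost; set Z := baryZ lam x.
set S := [set _ | _ in _].
have val y : \sum_i lam i / 2 * enorm (x i - y) ^+ 2 =
    \sum_i lam i / 2 * dot (x i) (x i) - dot Z Z / 2 + dot (Z - y) (Z - y) / 2.
  have -> : \sum_i lam i / 2 * enorm (x i - y) ^+ 2 =
     \sum_i lam i / 2 * dot (x i) (x i) - dot Z y + (\sum_i lam i) * (dot y y / 2).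
    rewrite /Z /baryZ dot_suml mulr_suml -sumrN -!big_split /=.
    apply: eq_bigr => i _; rewrite sqr_enorm !dotE (dotC y); lra.
  rewrite l1 !dotE (dotC y); lra.
have SZ : S (\sum_i lam i / 2 * dot (x i) (x i) - dot Z Z / 2).
  by exists Z => //; rewrite val subrr dot0l mul0r addr0.
have lb : lbound S (\sum_i lam i / 2 * dot (x i) (x i) - dot Z Z / 2).
  by move=> _ [y _ <-]; rewrite val lerDl divr_ge0 ?dot_ge0.
have -> : inf S = \sum_i lam i / 2 * dot (x i) (x i) - dot Z Z / 2.
  apply/eqP; rewrite eq_le ge_inf//=;
    last by exists (\sum_i lam i / 2 * dot (x i) (x i) - dot Z Z / 2).
  by apply: lb_le_inf => //; exists (\sum_i lam i / 2 * dot (x i) (x i) - dot Z Z / 2).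
lra.
Qed.

End CostFormula.

(** * Borel measurability of vectors *)

Lemma exists_invS_lt (R : realType) (r : R) : 0 < r -> exists k : nat, k.+1%:R^-1 < r.
Proof.
move=> r0; exists (Num.truncn r^-1); rewrite invf_plt ?posrE//.
have q0 : 0 <= r^-1 by rewrite invr_ge0 ltW.
by have /andP[] := truncn_itv q0.
Qed.

Section BorelRV.
Context {R : realType}.

(** A set that is relatively open for finitely many measurable real functions is
    a countable union of preimages of rational boxes. This one lemma yields all
    measurability of maps into, and of continuous functions of several, vectors. *)
Lemma measurable_locally_determined d (X : measurableType d) (D O : set X) (I : finType)
    (f : I -> X -> R) :
  measurable D -> (forall i, measurable_fun D (f i)) ->
  (forall x, D x -> O x -> exists2 r : R, 0 < r &
     forall y, D y -> (forall i, `|f i y - f i x| < r) -> O y) ->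
  measurable (D `&` O).
Proof.
move=> mD mf loc.
(* A centre for each function and a radius 1/(k+1) for all of them. *)
pose box (qs : {ffun I -> rat} * nat) := D `&`
  \bigcap_(i in [set: I]) (D `&` f i @^-1` ball (ratr (qs.1 i) : R) (qs.2.+1%:R^-1 : R)).
have -> : D `&` O = \bigcup_(qs in [set: {ffun I -> rat} * nat])
    [set x | box qs x /\ box qs `<=` O].
  apply/seteqP; split => [x [Dx Ox]|x [qs _ [bx bO]]]; last first.
    by split; [case: bx | exact: bO].
  have [r r0 rP] := loc x Dx Ox.
  have r20 : 0 < r / 2 by rewrite divr_gt0.
  have [s sP] := exists_invS_lt r20.
  have s0 : 0 < (s.+1%:R^-1 : R) by rewrite invr_gt0.
  have q_ i : exists q : rat, `|ratr q - f i x| < s.+1%:R^-1.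
    have [|q] := @rat_in_itvoo R (f i x) (f i x + s.+1%:R^-1); first by rewrite ltrDl.
    by rewrite in_itv /= => /andP[h1 h2]; exists q; rewrite ger0_norm ?ltrBlDl// subr_ge0 ltW.
  have [q qP] := choice q_.
  exists ([ffun i => q i], s) => //; split.
    by split => // i _; split => //=; rewrite /ball/= ffunE.
  move=> y [Dy yb]; apply: rP => // i.
  have [_] := yb i Logic.I; rewrite /ball/= ffunE => h.
  have {}h := lt_trans h sP; have h' := lt_trans (qP i) sP.
  rewrite -(subrKA (ratr (q i))) (le_lt_trans (ler_normD _ _))// distrC.
  by rewrite (splitr r) ltrD.
apply: countable_bigcupT_measurable => // qs.
have [bO|nbO] := pselect (box qs `<=` O).
  rewrite (_ : [set _ | _] = box qs).
    apply: measurableI => //; apply: fin_bigcap_measurable => // i _.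
    by apply: mf => //; apply: open_measurable; exact: ball_open.
  by apply/seteqP; split => [x []|].
by rewrite (_ : [set _ | _] = set0)//; apply/seteqP; split => // x [].
Qed.

Lemma open_measurable_mx m n (A : set 'M[R]_(m, n)) : open A -> measurable A.
Proof. exact: sub_sigma_algebra. Qed.

Lemma closed_measurable_mx m n (A : set 'M[R]_(m, n)) : closed A -> measurable A.
Proof.
by move=> cA; rewrite -(setCK A); apply: measurableC; apply: open_measurable_mx; exact:
  closed_openC.
Qed.

Lemma compact_measurable_mx m n (A : set 'M[R]_(m, n)) : compact A -> measurable A.
Proof.
by move=> cA; apply: closed_measurable_mx; apply: compact_closed => //; exact: norm_hausdorff.
Qed.

Lemma measurable_fun_coord m n i j :
  measurable_fun setT (fun x : 'M[R]_(m, n) => x i j).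
Proof.
apply: (measurability (@RGenOpens.G R)); first exact: RGenOpens.measurableE.
move=> _ [_ [a [b ->]] <-]; rewrite setTI; apply: open_measurable_mx.
apply: open_comp; last exact: interval_open.
by move=> x _; exact: coord_continuous.
Qed.

Lemma norm_mx_lt m n (x : 'M[R]_(m, n)) r : 0 < r -> (forall i j, `|x i j| < r) -> `|x| < r.
Proof.
move=> r0 h; have : ball (0 : 'M[R]_(m, n)) r x.
  by split => // i j; rewrite /ball/= mxE sub0r normrN.
by rewrite -ball_normE /= sub0r normrN.
Qed.

Lemma norm_coord m n (x : 'M[R]_(m, n)) i j : `|x i j| <= `|x|.
Proof.
apply/ler_addgt0Pr => e e0.
have : ball (0 : 'M[R]_(m, n)) (`|x| + e) x.
  by rewrite -ball_normE /= sub0r normrN ltrDl.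
by move=> [_ /(_ i j)]; rewrite /ball/= mxE sub0r normrN => /ltW.
Qed.

Lemma measurable_fun_mx d (X : measurableType d) (D : set X) m n (f : X -> 'M[R]_(m, n)) :
  measurable D -> (forall i j, measurable_fun D (fun x => f x i j)) -> measurable_fun D f.
Proof.
move=> mD mf; apply: (measurability (@open 'M[R]_(m, n))) => //.
move=> _ [B oB <-].
apply: (@measurable_locally_determined _ _ _ _ ('I_m * 'I_n)%type (fun ij x =>
  f x ij.1 ij.2)) => //.
move=> x Dx Bx.
have /nbhs_ballP[r /= r0 rB] : nbhs (f x) B by exact: open_nbhs_nbhs.
exists r => // y Dy h; apply: rB; rewrite -ball_normE /=.
apply: norm_mx_lt => // i j; rewrite !mxE distrC; exact: (h (i, j)).
Qed.

End BorelRV.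

(** * Lebesgue-null sets and parallel lines *)

Section LebesgueRV.
Context {R : realType}.

Definition rV_cons k (p : R * 'rV[R]_k) : 'rV[R]_k.+1 := row_mx (p.1)%:M p.2.

Lemma rV_cons0 k p : @rV_cons k p 0 ord0 = p.1.
Proof.
have -> : ord0 = lshift k (ord0 : 'I_1) by apply: val_inj.
by rewrite /rV_cons (@row_mxEl _ 1 1 k) mxE eqxx.
Qed.

Lemma rV_consS k p (j : 'I_k) : @rV_cons k p 0 (lift ord0 j) = p.2 0 j.
Proof.
have -> : lift ord0 j = rshift 1 j by apply: val_inj.
by rewrite /rV_cons (@row_mxEr _ 1 1 k).
Qed.

Lemma measurable_rV_cons k : measurable_fun setT (@rV_cons k).
Proof.
apply: measurable_fun_mx => // i j; rewrite (ord1 i).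
case: (unliftP ord0 j) => [l|] ->.
  under eq_fun do rewrite rV_consS.
  exact: (measurableT_comp (measurable_fun_coord _ _) measurable_snd).
by under eq_fun do rewrite rV_cons0; exact: measurable_fst.
Qed.

Lemma lebesgue_rVS k (A : set 'rV[R]_k.+1) :
  lebesgue_rV A = (@lebesgue_measure R \x lebesgue_rV (n := k))%E (@rV_cons k @^-1` A).
Proof. by []. Qed.

Lemma ball_rV_cons k (N : R) :
  @rV_cons k @^-1` ball (0 : 'rV[R]_k.+1) N = ball (0 : R) N `*` ball (0 : 'rV[R]_k) N.
Proof.
apply/seteqP; split => [[t v]|[t v]] /=.
  move=> [N0 h]; split => /=; last first.
    by split => // i j; have := h i (lift ord0 j); rewrite (ord1 i) rV_consS !mxE.
  by have := h ord0 ord0; rewrite rV_cons0 !mxE.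
move=> [h1 [N0 h2]]; split => // i j; rewrite (ord1 i).
case: (unliftP ord0 j) => [l|] ->.
  by have := h2 ord0 l; rewrite rV_consS !mxE.
by rewrite rV_cons0 mxE.
Qed.

(** The recursively defined set function is a product measure carried over by
    [rV_cons]; finiteness on balls is what makes the induction go through. *)
Lemma lebesgue_rV_measure n :
  exists m : {sigma_finite_measure set 'rV[R]_n -> \bar R},
    lebesgue_rV (n := n) = m /\ forall N : R, (m (ball (0%R : 'rV[R]_n) N) < +oo)%E.
Proof.
elim: n => [|k [mk [mkE mkN]]].
  exists (\d_(0 : 'rV[R]_0)); split => // N.
  by rewrite (le_lt_trans (probability_le1 _ _)) ?ltry//; apply: open_measurable_mx; exact:
    ball_open.
pose M := measure_function_pushforward__canonical__measure_function_Measure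
  (@lebesgue_measure R \x mk)%E (@measurable_rV_cons k).
have MN (N : R) : (M (ball (0%R : 'rV[R]_k.+1) N) < +oo)%E.
  rewrite /M /= /pushforward ball_rV_cons product_measure1E//; last 2 first.
  - by apply: open_measurable; exact: ball_open.
  - by apply: open_measurable_mx; exact: ball_open.
  rewrite lte_mul_pinfty// -[X in X \is a _]/(@lebesgue_measure R (ball (0 : R) N)).
  have [N0|N0] := leP 0 N; first by rewrite lebesgue_measure_ball.
  by rewrite (_ : ball _ _ = set0) ?measure0//; apply/seteqP; split => // x;
    rewrite /ball/= => /(le_lt_trans (normr_ge0 _)); rewrite ltNge ltW.
have sM : sigma_finite setT M.
  exists (fun N => ball (0 : 'rV[R]_k.+1) N%:R) => [|N].
    apply/esym/seteqP; split => // x _; exists (Num.truncn `|x|).+1 => //.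
    rewrite -ball_normE /= sub0r normrN.
    by have /andP[] := truncn_itv (normr_ge0 x).
  by split => //; apply: open_measurable_mx; exact: ball_open.
pose M' : {sigma_finite_measure set 'rV[R]_k.+1 -> \bar R} :=
  HB.pack (M : set _ -> _) (Measure.on M) (Measure_isSigmaFinite.Build _ _ _ M sM).
exists M'; split => //.
by apply/funext => A; rewrite lebesgue_rVS mkE.
Qed.

(** Induction on the dimension. If the direction is the first coordinate, the
    order of integration is exchanged; otherwise each slice at fixed first
    coordinate inherits the property. *)
Lemma lebesgue_rV_countable_lines n (i : 'I_n) (A : set 'rV[R]_n) : measurable A ->
  (forall x, countable [set t : R | A (x + t *: delta_mx 0 i)]) ->
  lebesgue_rV A = 0%E.
Proof.
elim: n i A => [[]//|k IH i A mA cA].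
have [mk [mkE _]] := lebesgue_rV_measure k.
rewrite lebesgue_rVS mkE.
have mB : measurable (@rV_cons k @^-1` A).
  by rewrite -[X in measurable X]setTI; exact: measurable_rV_cons.
case: (unliftP ord0 i) cA => [j|] -> cA.
  rewrite /product_measure1; apply: integral0_eq => t _ /=.
  rewrite -mkE; apply: (IH j); first exact: measurable_xsection.
  move=> x; apply: sub_countable (cA (rV_cons (t, x))); apply: subset_card_le.
  move=> s /=; rewrite /xsection /= inE /=; congr A.
  apply/rowP => l; rewrite [in RHS]mxE.
  by case: (unliftP ord0 l) => [l'|] ->;
    rewrite ?rV_consS ?rV_cons0 !mxE /= ?(inj_eq lift_inj) ?mulr0 ?addr0.
(* Exchange the order of integration. *)
rewrite (@product_measure_unique _ _ _ _ _ _ mk (@lebesgue_measure R \x^ mk)%E)//; last first.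
  by move=> B C mB' mC; exact: product_measure2E.
rewrite /product_measure2; apply: integral0_eq => x _ /=.
apply: countable_lebesgue_measure0.
apply: sub_countable (cA (rV_cons (0, x))); apply: subset_card_le.
move=> s /=; rewrite /ysection /= inE /=; congr A.
apply/rowP => l; rewrite [in RHS]mxE.
by case: (unliftP ord0 l) => [l'|] ->;
  rewrite ?rV_consS ?rV_cons0 !mxE /= ?mulr0 ?addr0 ?add0r ?mulr1.
Qed.

End LebesgueRV.

(** * Compactness in finite products *)

Section ProductCompactness.
Context {R : realType} {n : nat} {I : finType}.
Variable D : I -> set 'rV[R]_n.
Implicit Types (P : set (I -> 'rV[R]_n)) (f : (I -> 'rV[R]_n) -> R).

Definition inD (x : I -> 'rV[R]_n) := forall i, D i (x i).

(** Potentials are controlled on their domains only, so openness, closedness and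
    continuity are all taken relative to the product of the [D i]. *)
Definition rel_open P := forall x, inD x -> P x -> exists2 d : R, 0 < d &
  forall y, inD y -> (forall i, `|y i - x i| < d) -> P y.

Definition rel_closed P := rel_open (~` P).

Definition rel_cont f := forall x, inD x -> forall e : R, 0 < e -> exists2 d : R, 0 < d &
  forall y, inD y -> (forall i, `|y i - x i| < d) -> `|f y - f x| < e.

Lemma rel_closedI P Q : rel_closed P -> rel_closed Q -> rel_closed (P `&` Q).
Proof.
move=> cP cQ x Dx /not_andP[nP|nQ].
  by have [d d0 h] := cP x Dx nP; exists d => // y Dy yx [/(h y Dy yx)].
by have [d d0 h] := cQ x Dx nQ; exists d => // y Dy yx [_ /(h y Dy yx)].
Qed.

Lemma rel_closed_le f a : rel_cont f -> rel_closed [set x | f x <= a].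
Proof.
move=> cf x Dx /negP; rewrite -ltNge => afx.
have fa : 0 < f x - a by rewrite subr_gt0.
have [d d0 h] := cf x Dx _ fa; exists d => // y Dy yx; apply/negP; rewrite -ltNge.
by have := h y Dy yx; rewrite ltr_norml opprB ltrD2r => /andP[].
Qed.

Lemma rel_closed_coord i (C : set 'rV[R]_n) : closed C -> rel_closed [set x | C (x i)].
Proof.
move=> cC x Dx nC.
have /nbhs_ballP[r /= r0 rC] : nbhs (x i) (~` C).
  by apply: open_nbhs_nbhs; split => //; exact: closed_openC.
exists r => // y Dy yx; apply: rC; rewrite -ball_normE /= distrC; exact: yx.
Qed.

Hypothesis cD : forall i, compact (D i).

Let T := prod_topology (fun _ : I => 'rV[R]_n).

Lemma near_coords (x : T) (d : R) : 0 < d ->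
  \forall y \near x, forall i, `|(y : T) i - x i| < d.
Proof.
move=> d0; apply: (@filter_forall T I (fun i => [set y : T | `|y i - x i| < d]) (nbhs x) _ _) => i.
have := @proj_continuous I (fun _ => 'rV[R]_n) i x.
move=> /cvgrPdist_lt /(_ d d0) h.
apply: (@filterS _ (nbhs x) (nbhs_filter x) _ _ _ (h (nbhs_filter x))) => y.
by rewrite /proj distrC.
Qed.

Lemma compact_rel_closed P : rel_closed P -> compact ([set x | inD x /\ P x] : set T).
Proof.
move=> cP.
have cT : compact ([set x | inD x] : set T) by exact: (@tychonoff I (fun _ => 'rV[R]_n)).
apply: (subclosed_compact _ cT) => [x clx|x []//].
have Dx : inD x.
  have : closed ([set x | inD x] : set T).
    by apply: compact_closed => //; apply: hausdorff_product => i; exact: norm_hausdorff.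
  move=> h; apply: (h x) => B /clx[y [[Dy _] By]]; by exists y.
split => //; apply: contrapT => nP; have [d d0 h] := cP x Dx nP.
have [y [[Dy Py] yx]] := clx _ (near_coords x d0).
exact: (h y Dy yx Py).
Qed.

Lemma compact_proj i P : rel_closed P -> compact [set x i | x in [set x | inD x /\ P x]].
Proof.
move=> /compact_rel_closed cP.
have := @continuous_compact T _ (fun x : T => x i) _ _ cP; apply.
apply: continuous_subspaceT; exact: (@proj_continuous I (fun _ => 'rV[R]_n) i).
Qed.

Lemma attains_min P f : rel_closed P -> rel_cont f -> (exists2 x, inD x & P x) ->
  exists x, [/\ inD x, P x & forall y, inD y -> P y -> f x <= f y].
Proof.
move=> cP cf [x0 Dx0 Px0].
have [||x] := @compact_EVT_min T R f _ _ (compact_rel_closed cP).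
- by exists x0.
- apply/subspace_continuousP => x [Dx Px]; apply/cvgrPdist_lt => e e0.
  have [d d0 h] := cf x Dx e e0.
  rewrite nearE /within /= near_simpl.
  near=> y => -[Dy Py]; rewrite distrC; apply: h => //.
  near: y; exact: near_coords.
- rewrite inE => -[Dx Px] h; exists x; split => // y Dy Py; apply: h; rewrite inE.
  by split.
Unshelve. all: by end_near. Qed.

Lemma rel_cont_bounded f : rel_cont f -> exists2 M, 0 <= M & forall x, inD x -> `|f x| <= M.
Proof.
move=> cf.
have [[x0 Dx0]|nD] := pselect (exists x, inD x); last first.
  by exists 0 => // x Dx; exfalso; apply: nD; exists x.
have cn : rel_cont (fun x => - `|f x|).
  move=> x Dx e e0; have [d d0 h] := cf x Dx e e0; exists d => // y Dy yx.
  rewrite opprK addrC distrC.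
  by apply: le_lt_trans (h y Dy yx); exact: ler_dist_dist.
have cT : rel_closed setT by move=> x _ /(_ Logic.I).
have [|x [Dx _ h]] := attains_min cT cn; first by exists x0.
by exists `|f x| => // y Dy; rewrite -lerN2 h.
Qed.

End ProductCompactness.

(** * Integrals against probability measures *)

Section RealIntegrals.
Context d (T : measurableType d) (R : realType) (nu : probability T R).

Lemma probability1_nonempty (A : set T) : nu A = 1%E -> A !=set0.
Proof.
move=> A1; apply/set0P; apply: contra_eqN A1 => /eqP ->.
by rewrite measure0 eq_sym onee_neq0.
Qed.

Lemma bounded_integrable (A : set T) (f : T -> R) M : measurable A ->
  measurable_fun A f -> (forall x, A x -> `|f x| <= M) ->
  nu.-integrable A (EFin \o f).
Proof.
move=> mA mf fM; apply: measurable_bounded_integrable => //.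
  by rewrite (le_lt_trans (probability_le1 _ _)) ?ltry.
exists M; split; first exact: num_real.
by move=> r Mr x /fM /le_trans; apply; exact: ltW.
Qed.

Lemma Rintegral_indic (A B : set T) a : measurable A -> measurable B ->
  nu.-integrable A (EFin \o (fun x => a * \1_B x)) /\
  Rintegral nu A (fun x => a * \1_B x) = a * fine (nu (B `&` A)).
Proof.
move=> mA mB; have iB : nu.-integrable A (EFin \o (\1_B : T -> R)).
  apply: (@bounded_integrable _ _ 1) => // x _.
  by rewrite indicE; case: (_ \in _); rewrite ?normr1 ?normr0.
split; first exact: (integrableZl mA a iB).
rewrite RintegralZl//; congr (_ * _).
by rewrite /Rintegral integral_indic.
Qed.

Lemma Rintegral_sum (A : set T) (I : Type) (s : seq I) (f : I -> T -> R) : measurable A ->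
  (forall i, nu.-integrable A (EFin \o f i)) ->
  nu.-integrable A (EFin \o (fun x => \sum_(i <- s) f i x)) /\
  Rintegral nu A (fun x => \sum_(i <- s) f i x) = \sum_(i <- s) Rintegral nu A (f i).
Proof.
move=> mA hf; elim: s => [|i s [hs Es]].
  under [X in EFin \o X]eq_fun do rewrite big_nil.
  under eq_Rintegral do rewrite big_nil.
  rewrite big_nil /Rintegral integral0; split => //; exact: integrable0.
under [X in EFin \o X]eq_fun do rewrite big_cons.
under eq_Rintegral do rewrite big_cons.
rewrite big_cons; split; first exact: (integrableD mA (hf i) hs).
by rewrite (RintegralD mA (hf i) hs) Es.
Qed.

Lemma Rintegral_ae_ge0 (A : set T) (f : T -> R) : measurable A ->
  nu.-integrable A (EFin \o f) -> {ae nu, forall x, A x -> 0 <= f x} ->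
  0 <= Rintegral nu A f.
Proof.
move=> mA hf f0.
have mf : measurable_fun A f by apply/measurable_EFinP; have /integrableP[] := hf.
rewrite /Rintegral (ae_eq_integral (fun x => (Num.max (f x) 0)%:E))//.
- by apply: fine_ge0; apply: integral_ge0 => x _; rewrite lee_fin le_max lexx orbT.
- exact/measurable_EFinP.
- by apply/measurable_EFinP; apply: measurable_maxr.
- apply: filterS f0 => x h Ax; rewrite max_l//; exact: h.
Qed.

End RealIntegrals.

(** * Conjugate tuples and the dual problem *)

Section ConjugateTuples.
Context {R : realType} {n m : nat}.
Variables (c : ('I_m.+1 -> 'rV[R]_n) -> R) (D : 'I_m.+1 -> set 'rV[R]_n) (L : R).
Implicit Types phi : 'I_m.+1 -> 'rV[R]_n -> R.

Hypothesis L0 : 0 <= L.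
Hypothesis cL : forall x y, inD D x -> inD D y ->
  `|c x - c y| <= L * \sum_i `|x i - y i|.

Lemma inD_upd x i v : inD D x -> D i v -> inD D (upd x i v).
Proof. by move=> Dx Dv l; rewrite /upd; case: eqP => [->|_]. Qed.

Lemma upd_id (x : 'I_m.+1 -> 'rV[R]_n) i v : upd x i v i = v.
Proof. by rewrite /upd eqxx. Qed.

Lemma sum_upd_neq phi x i v :
  \sum_(j | j != i) phi j (upd x i v j) = \sum_(j | j != i) phi j (x j).
Proof. by apply: eq_bigr => j /negbTE ji; rewrite /upd ji. Qed.

Lemma c_upd_lip x i v w : inD D x -> D i v -> D i w ->
  c (upd x i v) <= c (upd x i w) + L * `|v - w|.
Proof.
move=> Dx Dv Dw; rewrite -lerBlDl (le_trans (ler_norm _))//.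
rewrite (le_trans (cL (inD_upd Dx Dv) (inD_upd Dx Dw)))//.
rewrite (bigD1 i)//= !upd_id big1 ?addr0// => j /negbTE ji.
by rewrite /upd ji subrr normr0.
Qed.

Lemma conj_le phi i x : c_conjugate c D phi -> inD D x ->
  phi i (x i) <= c x - \sum_(j | j != i) phi j (x j).
Proof.
move=> cphi Dx; rewrite -lee_fin cphi//; apply: ereal_inf_lbound.
by exists x.
Qed.

Lemma conj_ge phi i v b : c_conjugate c D phi -> D i v ->
  (forall x, inD D x -> x i = v -> b <= c x - \sum_(j | j != i) phi j (x j)) ->
  b <= phi i v.
Proof.
move=> cphi Dv h; rewrite -lee_fin cphi//; apply/le_ereal_inf_tmp.
by move=> _ [x [Dx xv] <-]; rewrite lee_fin; exact: h.
Qed.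

Lemma conj_adm phi x : c_conjugate c D phi -> inD D x ->
  \sum_i phi i (x i) <= c x.
Proof.
move=> cphi Dx; rewrite (bigD1 ord0)//= -lerBrDr.
exact: (conj_le ord0 cphi Dx).
Qed.

Definition lipschitz_on_D phi := forall i v w, D i v -> D i w ->
  `|phi i v - phi i w| <= L * `|v - w|.

(** An infimum of functions of one variable with a common Lipschitz constant. *)
Lemma conj_lip phi : c_conjugate c D phi -> lipschitz_on_D phi.
Proof.
move=> cphi.
suff h i v w : D i v -> D i w -> phi i v - phi i w <= L * `|v - w|.
  move=> i v w Dv Dw; rewrite ler_norml h// andbT lerNl opprB.
  by rewrite distrC h.
move=> Dv Dw; rewrite lerBlDr -lerBlDl; apply: (conj_ge cphi) => // x Dx xw.
have := conj_le i cphi (inD_upd Dx Dv); rewrite upd_id sum_upd_neq.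
have := c_upd_lip Dx Dv Dw.
have -> : upd x i w = x by apply/funext => l; rewrite /upd; case: eqP => // ->.
by rewrite -lerBlDl; lra.
Qed.

Lemma rel_cont_lip (f : ('I_m.+1 -> 'rV[R]_n) -> R) (K : R) : 0 <= K ->
  (forall x y, inD D x -> inD D y -> `|f x - f y| <= K * \sum_i `|x i - y i|) ->
  rel_cont D f.
Proof.
move=> K0 fK x Dx e e0.
have q0 : 0 < K * m.+1%:R + 1 by rewrite ltr_wpDl// mulr_ge0.
exists (e / (K * m.+1%:R + 1)); first exact: divr_gt0.
move=> y Dy yx; rewrite (le_lt_trans (fK _ _ Dy Dx))//.
apply: (@le_lt_trans _ _ (K * (m.+1%:R * (e / (K * m.+1%:R + 1))))).
  rewrite ler_wpM2l//.
  have -> : m.+1%:R * (e / (K * m.+1%:R + 1)) = \sum_(i < m.+1) (e / (K * m.+1%:R + 1)).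
    by rewrite sumr_const card_ord mulr_natl.
  by apply: ler_sum => i _; exact: ltW.
rewrite mulrA mulrA -[ltRHS]mulr1 -mulrA [ltLHS]mulrC -mulrA ltr_pM2l//.
by rewrite mulrC ltr_pdivrMr// mul1r ltrDl.
Qed.

Lemma residual_lip phi : lipschitz_on_D phi -> rel_cont D (residual c phi).
Proof.
move=> lphi; apply: (@rel_cont_lip _ (2 * L)) => [|x y Dx Dy]; first by rewrite mulr_ge0.
rewrite /residual.
have -> : c x - \sum_i phi i (x i) - (c y - \sum_i phi i (y i)) =
  (c x - c y) - \sum_i (phi i (x i) - phi i (y i)) by rewrite sumrB; lra.
rewrite (le_trans (ler_normB _ _))// -mulrA mulrDl mul1r lerD ?cL//.
rewrite (le_trans (ler_norm_sum _ _ _))// mulr_sumr; apply: ler_sum => i _.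
exact: lphi.
Qed.

Lemma lip_measurable phi i : compact (D i) -> lipschitz_on_D phi ->
  measurable_fun (D i) (phi i).
Proof.
move=> cDi lphi.
have mD : measurable (D i) by exact: compact_measurable_mx.
apply: (measurability (@RGenOpens.G R)); first exact: RGenOpens.measurableE.
move=> _ [_ [a [b ->]] <-].
apply: (@measurable_locally_determined R _ _ (D i) _ 'I_n (fun (j : 'I_n) (x : 'rV[R]_n) =>
  x 0 j)) => //.
  by move=> j; apply: measurable_funTS; exact: measurable_fun_coord.
move=> x Dx /= xab.
have : nbhs (phi i x) `]a, b[%classic by exact: near_in_itvoo.
move=> /nbhs_ballP[r /= r0 rB].
have L1 : 0 < L + 1 by rewrite ltr_wpDl.
exists (r / (L + 1)); first exact: divr_gt0.
move=> y Dy yx; apply: rB; rewrite /ball/=.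
have nxy : `|x - y| < r / (L + 1).
  by apply: norm_mx_lt => [|k j]; rewrite ?divr_gt0// !mxE (ord1 k) distrC.
rewrite (le_lt_trans (lphi _ _ _ Dx Dy))//.
have : `|x - y| * (L + 1) < r by rewrite -ltr_pdivlMr.
by apply: le_lt_trans; have := normr_ge0 (x - y); nra.
Qed.

Lemma lip_bounded phi i : compact (D i) -> lipschitz_on_D phi ->
  exists M, forall v, D i v -> `|phi i v| <= M.
Proof.
move=> cDi lphi; have [[v0 Dv0]|nD] := pselect (exists v, D i v); last first.
  by exists 0 => v Dv; exfalso; apply: nD; exists v.
have [N [Nr NP]] := compact_bounded cDi.
exists (`|phi i v0| + L * (2 * (`|N| + 1))) => v Dv.
have bd w : D i w -> `|w| <= `|N| + 1.
  by move=> Dw; apply: (NP _ _ w Dw); rewrite ltr_pwDr//; exact: ler_norm.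
rewrite -(subrK (phi i v0) (phi i v)) (le_trans (ler_normD _ _))// addrC lerD2l.
rewrite (le_trans (lphi _ _ _ Dv Dv0))// ler_wpM2l//.
by rewrite (le_trans (ler_normB _ _))// mulrDl mul1r lerD ?bd.
Qed.

End ConjugateTuples.

Section DualPerturbation.
Context {R : realType} {n m : nat}.
Variables (c : ('I_m.+1 -> 'rV[R]_n) -> R) (D : 'I_m.+1 -> set 'rV[R]_n).
Variable nu : 'I_m.+1 -> probability 'rV[R]_n R.
Implicit Types phi : 'I_m.+1 -> 'rV[R]_n -> R.

Lemma dual_valueE phi : (forall i, measurable (D i)) ->
  (forall i, (nu i).-integrable (D i) (EFin \o phi i)) ->
  dual_value D nu phi = (\sum_i Rintegral (nu i) (D i) (phi i))%:E.
Proof.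
move=> mD iphi; rewrite /dual_value -sumEFin; apply: eq_bigr => i _.
rewrite /Rintegral fineK//; have := iphi i; exact: integrable_fin_num.
Qed.

(** The points at which the first potential has to be lowered by [e] to make room
    for raising the [j]-th one by [e] on [C]. *)
Definition contact_slice phi (j : 'I_m.+1) (C : set 'rV[R]_n) (e : R) :=
  [set x ord0 | x in [set x | inD D x /\ (C (x j) /\ residual c phi x <= e)]].

Hypothesis cD : forall i, compact (D i).

Lemma contact_slice_compact phi j C e : closed C ->
  rel_cont D (residual c phi) -> compact (contact_slice phi j C e).
Proof.
move=> cC cr; apply: (@compact_proj _ _ _ D cD ord0 [set x | C (x j) /\ residual c phi x <= e]).
by apply: rel_closedI; [exact: rel_closed_coord | exact: rel_closed_le].
Qed.

(** Raise the [j]-th potential by [e] on [C] and lower the first one by [e] on the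
    slice: wherever the former is felt without the latter, the residual exceeds
    [e], so the new tuple is admissible. Its dual value cannot be larger. *)
Lemma contact_slice_le phi (j : 'I_m) C e : closed C -> 0 < e ->
  rel_cont D (residual c phi) -> conjugate_potentials c D nu phi ->
  (nu (lift ord0 j) (C `&` D (lift ord0 j)) <= nu ord0 (contact_slice phi (lift ord0 j) C e))%E.
Proof.
move=> cC e0 cr [[iphi adm] opt _].
set i := lift ord0 j; set E := contact_slice phi i C e.
have mD l : measurable (D l) by exact: compact_measurable_mx.
have mE : measurable E by apply: compact_measurable_mx; exact: contact_slice_compact.
have mC : measurable C by exact: closed_measurable_mx.
pose a (l : 'I_m.+1) : R := if l == i then e else if l == ord0 then - e else 0.
pose B (l : 'I_m.+1) := if l == i then C else E.
have mB l : measurable (B l) by rewrite /B; case: ifP.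
pose psi l x := phi l x + a l * \1_(B l) x.
have i0 : (i == ord0) = false by [].
have sum_a (f : 'I_m.+1 -> R) : \sum_l a l * f l = e * f i - e * f ord0.
  rewrite (bigD1 i)//= (bigD1 ord0)//= big1 ?addr0; last first.
    by move=> l /andP[/negbTE li /negbTE l0]; rewrite /a li l0 mul0r.
  by rewrite /a eqxx (eq_sym ord0) i0 eqxx mulNr.
have ipsi l : (nu l).-integrable (D l) (EFin \o psi l).
  have [ih _] := @Rintegral_indic _ _ _ (nu l) (D l) (B l) (a l) (mD l) (mB l).
  have := integrableD (mD l) (iphi l) ih.
  by apply: eq_integrable => // x _.
have adm_psi : dual_admissible c D nu psi.
  split => // x Dx; rewrite /psi big_split /=.
  rewrite (sum_a (fun l => \1_(B l) (x l))) /B eqxx (eq_sym ord0) i0.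
  have := adm x Dx.
  rewrite !indicE; have [xC|xC] := boolP (x i \in C); have [xE|xE] := boolP (x ord0 \in E);
    rewrite /= ?mulr1 ?mulr0; try lra.
  have : ~ residual c phi x <= e.
    by move=> h; move: xE; apply/negP/negPn; rewrite inE; exists x => //; split => //;
      split => //; rewrite -inE.
  by move/negP; rewrite -ltNge /residual; lra.
have := opt _ adm_psi; rewrite !dual_valueE// lee_fin.
have -> : \sum_l Rintegral (nu l) (D l) (psi l) = \sum_l Rintegral (nu l) (D l) (phi l) +
    \sum_l a l * fine (nu l (B l `&` D l)).
  rewrite -big_split /=; apply: eq_bigr => l _.
  have [ih <-] := @Rintegral_indic _ _ _ (nu l) (D l) (B l) (a l) (mD l) (mB l).
  by rewrite -RintegralD//; exact: iphi.
rewrite gerDl (sum_a (fun l => fine (nu l (B l `&` D l)))) /B eqxx (eq_sym ord0) i0.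
rewrite subr_le0 ler_pM2l//.
have -> : E `&` D ord0 = E.
  by apply/seteqP; split => [x []//|x Ex]; split => //; case: Ex => y [Dy _] <-.
by rewrite -lee_fin !fineK// fin_num_measure//; exact: measurableI.
Qed.

(** By compactness the slices at levels 1/(k+1) decrease to the slice at level 0. *)
Lemma contact_slice0_le phi (j : 'I_m) C : closed C ->
  rel_cont D (residual c phi) -> conjugate_potentials c D nu phi ->
  (nu (lift ord0 j) (C `&` D (lift ord0 j)) <= nu ord0 (contact_slice phi (lift ord0 j) C 0))%E.
Proof.
move=> cC cr cp; set i := lift ord0 j.
pose E k := contact_slice phi i C (k.+1%:R^-1 : R).
have mE k : measurable (E k) by apply: compact_measurable_mx; exact: contact_slice_compact.
have capE : \bigcap_k E k = contact_slice phi i C 0.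
  apply/seteqP; split => [v Ev|v [x [Dx [Cx rx]] <-] k _]; last first.
    by exists x => //; split => //; split => //; rewrite (le_trans rx).
  have cP : rel_closed D [set x | C (x i) /\ [set v] (x ord0)].
    by apply: rel_closedI; apply: rel_closed_coord => //; apply: compact_closed; [exact:
      norm_hausdorff|exact: compact_set1].
  have [|x [Dx [Cx xv] xmin]] := attains_min cD cP cr.
    by have [x [Dx [Cx _]] xv] := Ev 0%N Logic.I; exists x.
  exists x => //; split => //; split => //.
  apply/ler_addgt0Pr => e e0; rewrite add0r.
  have [k kP] := exists_invS_lt e0.
  have [y [Dy [Cy ry]] yv] := Ev k Logic.I.
  by rewrite (le_trans (xmin y Dy (conj Cy yv)))// (le_trans ry)// ltW.
have niE : nonincreasing_seq E.
  move=> k l kl; apply/subsetPset => v [x [Dx [Cx rx]] <-]; exists x => //.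
  by split => //; split => //; rewrite (le_trans rx)// lef_pV2 ?posrE// ler_nat.
have mcap : measurable (\bigcap_k E k) by exact: bigcapT_measurable.
have E0oo : (nu ord0 (E 0%N) < +oo)%E.
  by rewrite (le_lt_trans (probability_le1 _ _))// ltry.
have cv := nonincreasing_cvg_mu E0oo mE mcap niE.
rewrite -capE -(cvg_lim _ cv)//.
apply: lime_ge; first by apply/cvg_ex; eexists; exact: cv.
by apply: nearW => k; exact: contact_slice_le.
Qed.

End DualPerturbation.

(** * Image measures *)

Section Transfer.
Context d1 d2 (T1 : measurableType d1) (T2 : measurableType d2) (R : realType).
Variables (rho : probability T1 R) (mu : probability T2 R).
Variables (S : set T1) (t : T1 -> T2).
Hypotheses (mS : measurable S) (rhoS : rho S = 1%E) (mt : measurable_fun S t).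

Lemma probability_setC0 : rho (~` S) = 0%E.
Proof. by rewrite probability_setC// rhoS subee. Qed.

Lemma probability_setI1 A : measurable A -> rho (A `&` S) = rho A.
Proof.
move=> mA; rewrite -[in RHS](setIT A) -(setUv S) setIUr measureU//; last 3 first.
- exact: measurableI.
- by apply: measurableI => //; exact: measurableC.
- by rewrite setIACA setICr setI0.
rewrite [X in (_ + X)%E](_ : _ = 0%E) ?adde0//.
apply: (subset_measure0 _ _ _ probability_setC0) => //.
  by apply: measurableI => //; exact: measurableC.
exact: measurableC.
Qed.

Hypothesis push : forall A, measurable A -> rho (S `&` t @^-1` A) = mu A.

(** Change of variables for a map known on a set of full measure only; it is
    extended by a constant to a measurable map on the whole space, which has the
    same image measure. *)
Lemma integral_transfer (B : set T2) (f : T2 -> R) (M : R) : measurable B ->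
  (forall x, S x -> B (t x)) -> measurable_fun B f -> (forall y, B y -> `|f y| <= M) ->
  (\int[mu]_(y in B) (f y)%:E = \int[rho]_(x in S) (f (t x))%:E)%E.
Proof.
move=> mB tB mf fM.
have [x0 Sx0] := probability1_nonempty rhoS.
pose y0 := t x0.
pose t' x := if x \in S then t x else y0.
have mt' : measurable_fun setT t'.
  move=> _ B' mB'; rewrite setTI.
  rewrite (_ : _ @^-1` B' = (S `&` t @^-1` B') `|` (if y0 \in B' then ~` S else set0)).
    by apply: measurableU; [exact: mt|case: ifP => // _; exact: measurableC].
  apply/seteqP; split => x /=; rewrite /t'.
    case: ifPn => [|/negP]; rewrite inE => Sx Bx; first by left.
    by right; rewrite mem_set.
  case=> [[Sx Bx]|]; first by rewrite mem_set.
  case: ifPn => // /[!inE] By Sx.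
  by case: ifPn => //; rewrite inE.
have push' A : measurable A -> pushforward rho t' A = mu A.
  move=> mA; rewrite -push// /pushforward.
  have mtA : measurable (t' @^-1` A) by rewrite -[X in measurable X]setTI; exact: mt'.
  rewrite -probability_setI1//.
  congr (rho _); apply/seteqP; split => x [] /=.
    by move=> At Sx; split => //; move: At; rewrite /t' mem_set.
  by move=> Sx At; split => //; rewrite /t' mem_set.
pose f' := (EFin \o f) \_ B.
have mf' : measurable_fun setT f'.
  by apply/(measurable_restrictT _ mB); exact/measurable_EFinP.
have f'E y : f' y = (if y \in B then f y else 0)%:E by rewrite /f' /patch; case: ifP.
have if' : rho.-integrable setT (f' \o t').
  have := @bounded_integrable _ _ _ rho setT (fun x => fine (f' (t' x))) `|M|.
  have -> : EFin \o (fun x => fine (f' (t' x))) = f' \o t'.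
    by apply/funext => x /=; rewrite f'E.
  apply => //.
  - apply: (measurableT_comp (f := fine)) => //.
    exact: (measurableT_comp mf' mt').
  - move=> x _; rewrite f'E /=; case: ifPn => [|_]; last by rewrite normr0.
    by rewrite inE => /fM /le_trans; apply; exact: ler_norm.
rewrite integral_mkcond.
transitivity (\int[pushforward rho t']_y f' y)%E.
  pose P := measure_function_pushforward__canonical__measure_function_Measure rho mt'.
  by apply: (eq_measure_integral P) => A mA _; rewrite /P /= push'.
rewrite integral_pushforward//= preimage_setT [RHS]integral_mkcond.
apply: ae_eq_integral => //.
- exact: (measurableT_comp mf' mt').
- apply/(measurable_restrictT _ mS); apply/measurable_EFinP => /=.
  by apply: (measurable_comp mB _ mf mt) => _ [x Sx <-]; exact: tB.
exists (~` S); split; [exact: measurableC|exact: probability_setC0|].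
move=> x /= h Sx; apply: h => _; rewrite f'E patchE mem_set//= /t' mem_set//.
exact: tB.
Qed.

End Transfer.

Section MeasureOnClosed.
Context {R : realType} {n : nat}.

(** Comparison on closed sets reverses on open sets by complementation, and closed
    sets are decreasing limits of open ones, so the measures agree on open sets. *)
Lemma measure_eq_closed (m1 m2 : {measure set 'rV[R]_n -> \bar R}) :
  m1 setT = 1%E -> m2 setT = 1%E ->
  (forall C, closed C -> (m1 C <= m2 C)%E) ->
  forall A, measurable A -> m1 A = m2 A.
Proof.
move=> m11 m21 le12.
have fin (m : {measure set 'rV[R]_n -> \bar R}) A : m setT = 1%E -> measurable A ->
    m A \is a fin_num.
  move=> m1T mA; rewrite ge0_fin_numE// (@le_lt_trans _ _ 1%E) ?ltry// -m1T.
  by apply: le_measure; rewrite ?inE.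
have compl (m : {measure set 'rV[R]_n -> \bar R}) A : m setT = 1%E -> measurable A ->
    m (~` A) = (1 - m A)%E.
  move=> m1T mA; rewrite -m1T -(setUv A) measureU//; last 2 first.
  - exact: measurableC.
  - by rewrite setICr.
  by rewrite [X in (X - _)%E]addeC addeK// fin.
have open_le O : open O -> (m2 O <= m1 O)%E.
  move=> oO; have mO := open_measurable_mx oO.
  have mO' : measurable (~` O) by exact: measurableC.
  rewrite -(setCK O) (compl m1 (~` O))// (compl m2 (~` O))//.
  by rewrite leeB// le12//; exact: open_closedC.
have closed_eq C : closed C -> m1 C = m2 C.
  move=> cC; apply/eqP; rewrite eq_le le12//=.
  pose O (k : nat) := \bigcup_(y in C) ball y (k.+1%:R^-1 : R).
  have oO k : open (O k) by apply: bigcup_open => y _; exact: ball_open.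
  have mO k : measurable (O k) by exact: open_measurable_mx.
  have capO : \bigcap_k O k = C.
    apply/seteqP; split => [x Ox|x Cx k _]; last by exists x => //; exact: ballxx.
    apply: cC => B /nbhs_ballP[r /= r0 rB].
    have [k kP] := exists_invS_lt r0.
    have [y Cy yx] := Ox k Logic.I; exists y; split => //; apply: rB.
    by apply: ball_sym; apply: le_ball yx; exact: ltW.
  have niO : nonincreasing_seq O.
    move=> k l kl; apply/subsetPset => x [y Cy yx]; exists y => //.
    by apply: le_ball yx; rewrite lef_pV2 ?posrE// ler_nat.
  have mcap : measurable (\bigcap_k O k) by exact: bigcapT_measurable.
  have O0 (m : {measure set 'rV[R]_n -> \bar R}) : m setT = 1%E -> (m (O 0%N) < +oo)%E.
    by move=> h; have := fin m (O 0%N) h (mO _); rewrite ge0_fin_numE.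
  have cv1 := nonincreasing_cvg_mu (O0 m1 m11) mO mcap niO.
  have cv2 := nonincreasing_cvg_mu (O0 m2 m21) mO mcap niO.
  rewrite -capO -(cvg_lim _ cv1)// -(cvg_lim _ cv2)//.
  apply: lee_lim; [by apply/cvg_ex; eexists; exact: cv2|by apply/cvg_ex; eexists; exact: cv1|].
  by apply: nearW => k; exact: open_le.
have open_eq O : open O -> m1 O = m2 O.
  move=> oO; have mO := open_measurable_mx oO.
  have mO' : measurable (~` O) by exact: measurableC.
  rewrite -(setCK O) (compl m1 (~` O))// (compl m2 (~` O))//.
  by rewrite closed_eq//; exact: open_closedC.
move=> A mA; apply: (@g_sigma_algebra_measure_unique _ R _ (@open 'rV[R]_n) _ (fun=> setT)) => //.
- by move=> B; exact: open_measurable_mx.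
- by move=> _; exact: openT.
- by apply: bigcup_const; exists 0%N.
- by move=> B C; exact: openI.
- by move=> k; rewrite m11 ltry.
Qed.

End MeasureOnClosed.

(** * Lipschitz continuity of the cost *)

Section CostLipschitz.
Context {R : realType} {n m : nat}.
Variables (lam : 'I_m.+1 -> R) (D : 'I_m.+1 -> set 'rV[R]_n).
Variables (G : 'rV[R]_n -> R) (g : 'rV[R]_n -> 'rV[R]_n) (Om : set 'rV[R]_n) (k b : R).
Variable c : ('I_m.+1 -> 'rV[R]_n) -> R.
Hypotheses (l0 : forall i, 0 < lam i) (l1 : \sum_i lam i = 1).
Hypothesis cD : forall i, compact (D i).
Hypothesis DOm : forall x, inD D x -> Om (baryZ lam x).
Hypothesis qb : quad_bounds G g Om k b.
Hypothesis k0 : 0 <= k.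
Hypothesis gcont : forall i z, Om z -> {for z, continuous (fun z => g z 0 i)}.
Hypothesis cE : forall x, c x = \sum_i lam i / 2 * dot (x i) (x i) - G (baryZ lam x).

Lemma enorm_le_norm (x : 'rV[R]_n) : enorm x <= n%:R * `|x|.
Proof.
rewrite -(@ler_pXn2r _ 2)// ?nnegrE ?enorm_ge0 ?mulr_ge0// sqr_enorm.
apply: (@le_trans _ _ (\sum_(i < n) `|x| ^+ 2)).
  apply: ler_sum => i _; rewrite -expr2 -(ger0_norm (sqr_ge0 (x 0 i))) normrX.
  by rewrite lerXn2r ?nnegrE// norm_coord.
rewrite sumr_const card_ord -[leLHS]mulr_natl exprMn ler_wpM2r ?sqr_ge0//.
by case: n => [|k']; rewrite ?expr0n// expr2 ler_peMr// ler1n.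
Qed.

Lemma lam_le1 i : lam i <= 1.
Proof. by rewrite -l1 (bigD1 i)//= lerDl sumr_ge0// => j _; exact: ltW. Qed.

Lemma baryZ_lip (x y : 'I_m.+1 -> 'rV[R]_n) : `|baryZ lam x - baryZ lam y| <= \sum_i `|x i - y i|.
Proof.
rewrite /baryZ -sumrB (le_trans (ler_norm_sum _ _ _))//; apply: ler_sum => i _.
rewrite -scalerBr normrZ ger0_norm; last exact: ltW.
by rewrite ler_piMl// lam_le1.
Qed.

Lemma rel_cont_baryZ (h : 'rV[R]_n -> R) :
  (forall z, Om z -> {for z, continuous h}) -> rel_cont D (h \o baryZ lam).
Proof.
move=> hc x Dx e e0.
have /cvgrPdist_lt/(_ e e0) := hc _ (DOm Dx).
move=> /nbhs_ballP[r /= r0 rB].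
exists (r / m.+1%:R); first by rewrite divr_gt0.
move=> y Dy yx; rewrite distrC; apply: rB; rewrite -ball_normE /= distrC.
rewrite (le_lt_trans (baryZ_lip _ _))//.
have -> : r = \sum_(i < m.+1) (r / m.+1%:R).
  by rewrite sumr_const card_ord -[RHS]mulr_natr divfK.
apply: ltr_sum => [|i _]; last exact: yx.
by apply/hasP; exists ord0; rewrite ?mem_index_enum.
Qed.

Lemma g_bounded : exists2 M, 0 <= M & forall x, inD D x -> enorm (g (baryZ lam x)) <= M.
Proof.
have /choice[M MP] i : exists M, 0 <= M /\ forall x, inD D x -> `|g (baryZ lam x) 0 i| <= M.
  by have [M M0 h] := rel_cont_bounded cD (rel_cont_baryZ (@gcont i)); exists M.
pose B := \sum_i M i; have B0 : 0 <= B by apply: sumr_ge0 => i _; have [] := MP i.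
exists (n%:R * (B + 1)) => [|x Dx]; first by rewrite mulr_ge0// addr_ge0.
rewrite (le_trans (enorm_le_norm _))// ler_wpM2l//.
apply/ltW; apply: norm_mx_lt => [|i j]; first by rewrite ltr_wpDl.
rewrite (ord1 i); have [_ /(_ x Dx) h] := MP j.
apply: le_lt_trans h _; rewrite /B (bigD1 j)//= -addrA ltrDl ltr_wpDl//.
by apply: sumr_ge0 => l _; have [] := MP l.
Qed.

Lemma D_bounded : exists2 M, 0 <= M & forall i v, D i v -> `|v| <= M.
Proof.
have /choice[M MP] i : exists M, 0 <= M /\ forall v, D i v -> `|v| <= M.
  have [N [Nr NP]] := compact_bounded (@cD i); exists (`|N| + 1); split; first by rewrite addr_ge0.
  move=> v Dv; apply: (NP _ _ v Dv); rewrite ltr_pwDr//; exact: ler_norm.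
exists (\sum_i M i) => [|i v Dv]; first by apply: sumr_ge0 => i _; have [] := MP i.
have [_ /(_ v Dv) h] := MP i; apply: le_trans h _.
by rewrite (bigD1 i)//= lerDl; apply: sumr_ge0 => l _; have [] := MP l.
Qed.

(** [G] is Lipschitz on barycenters because its gradient is continuous on the
    compact set that they fill. *)
Lemma cost_lip : exists2 L, 0 <= L & forall x y, inD D x -> inD D y ->
  `|c x - c y| <= L * \sum_i `|x i - y i|.
Proof.
have [Mg Mg0 gM] := g_bounded; have [M M0 DM] := D_bounded.
exists (n%:R * n%:R * M + Mg * n%:R) => [|x y Dx Dy].
  by rewrite addr_ge0// !mulr_ge0.
rewrite !cE (_ : _ - _ = \sum_i (lam i / 2 * dot (x i) (x i) - lam i / 2 * dot (y i) (y i))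
   - (G (baryZ lam x) - G (baryZ lam y))); last by rewrite sumrB; lra.
rewrite (le_trans (ler_normB _ _))// mulrDl lerD//.
  rewrite (le_trans (ler_norm_sum _ _ _))// mulr_sumr; apply: ler_sum => i _.
  rewrite -mulrBr (_ : dot _ _ - _ = dot (x i - y i) (x i + y i)); last first.
    by rewrite !dotE (dotC (y i)); lra.
  have CS (u v : 'rV[R]_n) : `|dot u v| <= enorm u * enorm v.
    rewrite ler_norml dot_le_enorm andbT lerNl -dotNl -(enormN u).
    exact: dot_le_enorm.
  have l01 : 0 <= lam i / 2 <= 1 / 2.
    by rewrite divr_ge0 ?(ltW (l0 i))//= ler_wpM2r// lam_le1.
  have xy : enorm (x i + y i) <= n%:R * (2 * M).
    rewrite (le_trans (enorm_le_norm _))// ler_wpM2l// (le_trans (ler_normD _ _))//.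
    by rewrite mulrDl mul1r lerD// (DM i).
  rewrite normrM ger0_norm; last by have /andP[] := l01.
  have /andP[la lb] := l01.
  apply: (@le_trans _ _ (1 / 2 * (n%:R * `|x i - y i| * (n%:R * (2 * M))))); last by lra.
  apply: ler_pM => //; apply: (le_trans (CS _ _)).
  by apply: ler_pM => //; rewrite ?enorm_ge0 ?enorm_le_norm.
have := quad_bounds_lip k0 qb (DOm Dx) (DOm Dy) (gM x Dx) (gM y Dy).
move=> /le_trans; apply; rewrite -mulrA ler_wpM2l//.
rewrite (le_trans (enorm_le_norm _))// ler_wpM2l//; exact: baryZ_lip.
Qed.

End CostLipschitz.

(** * Almost everywhere uniqueness of contact tuples *)

Section Fcons.
Context {A : Type} {m : nat}.
Lemma fcons0 (a : A) (f : 'I_m -> A) : fcons a f ord0 = a.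
Proof. by rewrite /fcons unlift_none. Qed.
Lemma fconsS (a : A) (f : 'I_m -> A) j : fcons a f (lift ord0 j) = f j.
Proof. by rewrite /fcons liftK. Qed.
End Fcons.

Section PairedTuples.
Context {R : realType} {n m : nat}.
Variable (D : 'I_m.+1 -> set 'rV[R]_n).

(** Pairs of tuples are encoded as families over [bool * 'I_m.+1], so that the
    compactness results for products apply to them. *)
Definition pair_dom (a : (bool * 'I_m.+1)%type) := D a.2.
Definition pair_half (b : bool) (x : bool * 'I_m.+1 -> 'rV[R]_n) : 'I_m.+1 -> 'rV[R]_n :=
  fun i => x (b, i).

Lemma inD_pair_half x b : inD pair_dom x -> inD D (pair_half b x).
Proof. by move=> Dx i; exact: (Dx (b, i)). Qed.

Lemma rel_cont_pair_half b f : rel_cont D f -> rel_cont pair_dom (f \o pair_half b).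
Proof.
move=> cf x Dx e e0; have [d d0 h] := cf _ (@inD_pair_half x b Dx) e e0.
exists d => // y Dy yx; apply: h; first exact: inD_pair_half.
by move=> i; exact: yx.
Qed.

Lemma rel_closed_eq (I : finType) (E : I -> set 'rV[R]_n) i j :
  rel_closed E [set x | x i = x j].
Proof.
move=> x Ex /eqP xij; have r0 : 0 < `|x i - x j| by rewrite normr_gt0 subr_eq0.
exists (`|x i - x j| / 2) => [|y Ey yx yij]; first by rewrite divr_gt0.
have := yx i; have := yx j; rewrite yij => h1; rewrite distrC => h2.
have : `|x i - x j| < `|x i - x j| / 2 + `|x i - x j| / 2.
  by rewrite -{1}(subrKA (y j)) (le_lt_trans (ler_normD _ _))// ltrD.
by rewrite -splitr ltxx.
Qed.

End PairedTuples.

Section ContactUniqueness.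
Context {R : realType} {n m : nat}.
Variables (lam : 'I_m.+1 -> R) (D : 'I_m.+1 -> set 'rV[R]_n).
Variables (G : 'rV[R]_n -> R) (g : 'rV[R]_n -> 'rV[R]_n) (Om : set 'rV[R]_n) (k b : R).
Variable c : ('I_m.+1 -> 'rV[R]_n) -> R.
Variable phi : 'I_m.+1 -> 'rV[R]_n -> R.
Hypotheses (l0 : forall i, 0 < lam i) (l1 : \sum_i lam i = 1).
Hypothesis cD : forall i, compact (D i).
Hypothesis DOm : forall x, inD D x -> Om (baryZ lam x).
Hypothesis qb : quad_bounds G g Om k b.
Hypothesis k0 : 0 < k.
Hypothesis gcont : forall i z, Om z -> {for z, continuous (fun z => g z 0 i)}.
Hypothesis cE : forall x, c x = \sum_i lam i / 2 * dot (x i) (x i) - G (baryZ lam x).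
Hypothesis adm : forall x, inD D x -> \sum_i phi i (x i) <= c x.
Hypothesis rcont : rel_cont D (residual c phi).

Definition contact x := inD D x /\ residual c phi x <= 0.

(** Exchange the first entries of [x] and [y]: the two new tuples have nonnegative
    residual, and the convexity of [G] bounds the change of cost. *)
Lemma contact_monotone x y : contact x -> contact y ->
  0 <= dot (y ord0 - x ord0) (g (baryZ lam y) - g (baryZ lam x)).
Proof.
move=> [Dx rx] [Dy ry].
pose x' := upd x ord0 (y ord0); pose y' := upd y ord0 (x ord0).
have Dx' : inD D x' by apply: inD_upd => //; exact: Dy.
have Dy' : inD D y' by apply: inD_upd => //; exact: Dx.
have := adm Dx'; have := adm Dy'; move: rx ry.
have := qb (DOm Dx) (DOm Dx'); have := qb (DOm Dy) (DOm Dy').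
rewrite /residual !cE /x' /y' !baryZ_upd !(sum_upd phi).
rewrite !(sum_upd (fun l y => lam l / 2 * dot y y)).
set u := y ord0; set v := x ord0.
rewrite ![baryZ lam _ + _ - _]addrC !addKr -[v - u]opprB !scalerN !dotNl !dotNr opprK.
set w := lam ord0 *: (u - v).
have := dot_ge0 w.
set zz := dot w w => z0 /andP[h1 _] /andP[h2 _] h3 h4 h5 h6.
have kz : 0 <= k / 2 * zz by rewrite mulr_ge0// divr_ge0// ltW.
have : 0 <= dot (g (baryZ lam y)) w - dot (g (baryZ lam x)) w by lra.
rewrite /w !dotZr -mulrBr pmulr_rge0// => /le_trans; apply.
by rewrite [leRHS]dotC dotDl dotNl.
Qed.

(** Strong monotonicity makes the barycenters equal, and then the exchange
    inequality leaves no room for different entries. *)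
Lemma contact_eq x x' : contact x -> contact x' -> x ord0 = x' ord0 ->
  g (baryZ lam x) = g (baryZ lam x') -> x = x'.
Proof.
move=> [Dx rx] [Dx' rx'] x0 gxx'.
have ZZ : baryZ lam x = baryZ lam x'.
  have := quad_bounds_mono qb (DOm Dx) (DOm Dx').
  rewrite gxx' subrr dot0l pmulr_rle0// => h.
  apply/eqP; rewrite eq_sym -subr_eq0 -dot_eq0 eq_le h dot_ge0//.
have r0 : residual c phi x' = 0.
  by apply/eqP; rewrite eq_le rx' subr_ge0 adm.
have := residual_ge_swaps cE DOm qb adm Dx Dx' x0 r0.
rewrite ZZ subrr dot0l mulr0 subr0 => /le_trans /(_ rx).
rewrite pmulr_rle0 ?divr_gt0// => h.
have {}h : \sum_(j < m) dot (lam (lift ord0 j) *: (x (lift ord0 j) - x' (lift ord0 j)))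
   (lam (lift ord0 j) *: (x (lift ord0 j) - x' (lift ord0 j))) == 0.
  by rewrite eq_le h sumr_ge0// => j _; exact: dot_ge0.
apply/funext => i; case: (unliftP ord0 i) => [j|] -> //.
move: h; rewrite psumr_eq0; last by move=> ? _; exact: dot_ge0.
move=> /allP/(_ j); rewrite mem_index_enum => /(_ isT) /=.
by rewrite dot_eq0 scaler_eq0 gt_eqF//= subr_eq0 => /eqP.
Qed.

(** The first entries shared by two contact tuples that the values [q] and [q']
    of the [i]-th component of the gradient at the barycenter separate. It is
    written as a coordinate projection of a relatively closed set of pairs. *)
Definition split_set (i : 'I_n) (q q' : R) : set 'rV[R]_n :=
  [set z (true, ord0) | z in [set z : (bool * 'I_m.+1)%type -> 'rV[R]_n |
    inD (pair_dom D) z /\ ([set z | z (true, ord0) = z (false, ord0)] `&`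
    ([set z | (residual c phi \o pair_half true) z <= 0] `&`
     [set z | (residual c phi \o pair_half false) z <= 0] `&`
    ([set z | ((fun z => g z 0 i) \o baryZ lam \o pair_half true) z <= q] `&`
     [set z | ((fun z => - g z 0 i) \o baryZ lam \o pair_half false) z <= - q']))) z]].

Lemma split_set_compact i q q' : compact (split_set i q q').
Proof.
apply: (@compact_proj _ _ _ (pair_dom D) _ (true, ord0)) => [a|]; first exact: cD.
apply: rel_closedI; first exact: rel_closed_eq.
have gc := rel_cont_baryZ l0 l1 DOm (@gcont i).
have gc' := rel_cont_baryZ l0 l1 DOm (fun z Oz => continuousN (@gcont i z Oz)).
by repeat apply: rel_closedI; apply: rel_closed_le; exact: rel_cont_pair_half.
Qed.

Lemma split_setP i q q' x0 : split_set i q q' x0 -> exists x x', [/\ contact x, contact x',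
  x ord0 = x0, x' ord0 = x0 & g (baryZ lam x) 0 i <= q /\ q' <= g (baryZ lam x') 0 i].
Proof.
move=> [z [Dz [/= e [[r1 r2] [q1 q2]]]] <-].
exists (pair_half true z), (pair_half false z); split => //.
- by split => //; exact: inD_pair_half.
- by split => //; exact: inD_pair_half.
- by split => //; rewrite -lerN2.
Qed.

Lemma split_setI i q q' x x' : contact x -> contact x' -> x ord0 = x' ord0 ->
  g (baryZ lam x) 0 i <= q -> q' <= g (baryZ lam x') 0 i -> split_set i q q' (x ord0).
Proof.
move=> [Dx rx] [Dx' rx'] e gx gx'.
exists (fun a => if a.1 then x a.2 else x' a.2) => //; split.
  by move=> [[] l]; [exact: Dx|exact: Dx'].
by split => //; split => //; split => //=; rewrite lerN2.
Qed.

(** Two such points on one line parallel to the [i]-th axis would contradict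
    [contact_monotone]. *)
Lemma split_set_line i q q' x s t : q < q' -> split_set i q q' (x + s *: 'e_i) ->
  split_set i q q' (x + t *: 'e_i) -> ~ s < t.
Proof.
move=> qq' /split_setP[_ [xs [_ cs _ es [_ gs]]]] /split_setP[xt [_ [ct _ et _ [gt _]]]] st.
have := contact_monotone cs ct; rewrite es et.
have -> : x + t *: 'e_i - (x + s *: 'e_i) = (t - s) *: 'e_i.
  by rewrite opprD addrACA subrr add0r scalerBl.
rewrite dotZl pmulr_rge0 ?subr_gt0// /dot (bigD1 i)//= big1 ?addr0; last first.
  by move=> j /negbTE ji; rewrite mxE eqxx ji mul0r.
rewrite !mxE !eqxx mul1r; lra.
Qed.

Lemma split_set_null i q q' : q < q' -> (@lebesgue_rV R n).-null_set (split_set i q q').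
Proof.
move=> qq' B mB sB; apply: (lebesgue_rV_countable_lines (i := i)) => // x.
set A := [set t | _].
have h s t : A s -> A t -> ~ s < t by move=> /sB bs /sB bt; exact: (split_set_line qq' bs bt).
have [->|/set0P[s As]] := eqVneq A set0; first exact: countable0.
apply: (@sub_countable _ _ _ [set s]) => //; apply: subset_card_le => t At /=.
by apply/eqP; rewrite eq_le !leNgt; apply/andP; split; apply/negP; exact: h.
Qed.

(** If two contact tuples share their first entry, some component of the gradient
    differs, and rational numbers fit in between; hence countably many null sets
    cover all first entries with several contact tuples. *)
Lemma contact_unique_ae (rho : probability 'rV[R]_n R) : rho `<< @lebesgue_rV R n ->
  exists2 N, measurable N /\ rho N = 0%E & forall x x', contact x -> contact x' ->
    x ord0 = x' ord0 -> ~ N (x ord0) -> x = x'.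
Proof.
move=> dom.
pose F (p : 'I_n * (rat * rat)) := if ratr p.2.1 < ratr p.2.2 :> R
  then split_set p.1 (ratr p.2.1) (ratr p.2.2) else set0.
have mF p : measurable (F p).
  by rewrite /F; case: ifP => // _; apply: compact_measurable_mx; exact: split_set_compact.
have F0 p : rho (F p) = 0%E.
  rewrite /F; case: ifPn => [lt|_]; last by rewrite measure0.
  apply: (dom _ (split_set_null lt)); last exact: subset_refl.
  by apply: compact_measurable_mx; exact: split_set_compact.
pose N := \bigcup_(p in [set: 'I_n * (rat * rat)]) F p.
have mN : measurable N by apply: countable_bigcupT_measurable.
exists N.
  split => //; apply/eqP; rewrite -measure_le0.
  pose E k := oapp F set0 (unpickle k).
  have -> : N = \bigcup_k E k.
    apply/seteqP; split => [x [p _ Fp]|x [k' _]].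
      by exists (pickle p) => //; rewrite /E pickleK.
    by rewrite /E; case: unpickle => //= p Fp; exists p.
  have mE k' : measurable (E k') by rewrite /E; case: unpickle => [p|] /=; [exact:
    mF|exact: measurable0].
  rewrite (le_trans (measure_sigma_subadditive _ _ _ (@subset_refl _ (\bigcup_k E k))))//.
    exact: bigcupT_measurable.
  rewrite eseries0// => k' _ _; rewrite /E.
  by case: unpickle => [p|] /=; [exact: F0|exact: measure0].
move=> x x' cx cx' xx' nN; apply: contact_eq => //.
apply: contrapT => gne; apply: nN.
have [i gi] : exists i, g (baryZ lam x) 0 i != g (baryZ lam x') 0 i.
  apply: contrapT => h; apply: gne; apply/rowP => i; apply/eqP.
  by apply/negPn/negP => gi; apply: h; exists i.
have sep y y' : contact y -> contact y' -> y ord0 = y' ord0 ->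
    g (baryZ lam y) 0 i < g (baryZ lam y') 0 i -> N (y ord0).
  move=> cy cy' yy' lt.
  have [q] := rat_in_itvoo lt; rewrite in_itv/= => /andP[q1 q2].
  have [q'] := rat_in_itvoo q2; rewrite in_itv/= => /andP[q3 q4].
  exists (i, (q, q')) => //; rewrite /F /= q3.
  by apply: (split_setI cy cy' yy'); exact: ltW.
move: gi; rewrite neq_lt => /orP[lt|lt]; first exact: (sep _ _ cx cx').
by rewrite xx'; exact: (sep _ _ cx' cx).
Qed.

End ContactUniqueness.

(** * Optimal maps and the contact set *)

Section TransportIntegrals.
Context {R : realType} {n m : nat}.
Variables (S Y : set 'rV[R]_n) (rho : probability 'rV[R]_n R).
Variable mu : 'I_m -> probability 'rV[R]_n R.
Variables (c : ('I_m.+1 -> 'rV[R]_n) -> R) (L : R).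
Hypotheses (cS : compact S) (cY : compact Y) (rhoS : rho S = 1%E).
Hypothesis L0 : 0 <= L.

Let D := fcons S (fun _ : 'I_m => Y).
Let nu := fcons rho mu.

Hypothesis cL : forall x y, inD D x -> inD D y ->
  `|c x - c y| <= L * \sum_i `|x i - y i|.

Lemma fcons_compact i : compact (D i).
Proof. by case: (unliftP ord0 i) => [j|] ->; rewrite /D ?fconsS ?fcons0. Qed.

Let mS : measurable S. Proof. exact: compact_measurable_mx. Qed.

Section WithMaps.
Variable T : 'I_m -> 'rV[R]_n -> 'rV[R]_n.
Hypothesis TT : transport_maps S Y rho mu T.

Lemma inD_tuple x : S x -> inD D (transport_tuple T x).
Proof.
move=> Sx i; rewrite /D /transport_tuple; case: (unliftP ord0 i) => [j|] ->.
  by rewrite !fconsS; have [_ + _] := TT j; apply.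
by rewrite !fcons0.
Qed.

Lemma measurable_tuple_coord i : measurable_fun S (fun x => transport_tuple T x i).
Proof.
rewrite /transport_tuple; case: (unliftP ord0 i) => [j|] ->.
  by under eq_fun do rewrite fconsS; have [] := TT j.
by under eq_fun do rewrite fcons0; exact: measurable_id.
Qed.

(** Every coordinate of the transport tuple carries [rho] to its marginal,
    including the first one, which is the identity on [S]. *)
Lemma push_tuple i A : measurable A ->
  rho (S `&` (fun x => transport_tuple T x i) @^-1` A) = nu i A.
Proof.
move=> mA; rewrite /transport_tuple /nu; case: (unliftP ord0 i) => [j|] ->.
  rewrite fconsS; have [_ _ <- //] := TT j; congr (rho (_ `&` _)).
  by apply/seteqP; split => x /=; rewrite fconsS.
rewrite fcons0 (_ : _ @^-1` A = A); last first.
  by apply/seteqP; split => x /=; rewrite fcons0.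
by rewrite setIC probability_setI1.
Qed.

Lemma measurable_tuple f : rel_cont D f ->
  measurable_fun S (fun x => f (transport_tuple T x)).
Proof.
move=> cf; apply: (measurability (@RGenOpens.G R)); first exact: RGenOpens.measurableE.
move=> _ [_ [a [b ->]] <-].
apply: (@measurable_locally_determined R _ _ S _ ('I_m.+1 * 'I_n)%type
  (fun ij x => transport_tuple T x ij.1 0 ij.2)) => //.
  move=> ij; apply: (measurableT_comp (measurable_fun_coord 0 ij.2)).
  exact: measurable_tuple_coord.
move=> x Sx /= xab.
have : nbhs (f (transport_tuple T x)) `]a, b[%classic by exact: near_in_itvoo.
move=> /nbhs_ballP[r /= r0 rB].
have [d d0 h] := cf _ (inD_tuple Sx) r r0; exists d => // y Sy yx.
apply: rB; rewrite /ball/= distrC; apply: h; first exact: inD_tuple.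
move=> i; apply: norm_mx_lt => // k j; rewrite !mxE (ord1 k); exact: (yx (i, j)).
Qed.

Lemma integrable_tuple f : rel_cont D f ->
  rho.-integrable S (EFin \o (fun x => f (transport_tuple T x))).
Proof.
move=> cf; have [M M0 fM] := rel_cont_bounded fcons_compact cf.
apply: (@bounded_integrable _ _ _ _ _ _ M) => //; first exact: measurable_tuple.
by move=> x Sx; apply: fM; exact: inD_tuple.
Qed.

Lemma cost_rel_cont : rel_cont D c.
Proof. exact: (rel_cont_lip L0). Qed.

Lemma rel_cont_coord phi i : lipschitz_on_D D L phi -> rel_cont D (fun x => phi i (x i)).
Proof.
move=> lphi; apply: (rel_cont_lip L0) => x y Dx Dy.
rewrite (le_trans (lphi _ _ _ (Dx i) (Dy i)))// ler_wpM2l//.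
by rewrite (bigD1 i)//= lerDl sumr_ge0.
Qed.

Lemma integral_tuple_coord phi i : lipschitz_on_D D L phi ->
  Rintegral rho S (fun x => phi i (transport_tuple T x i)) =
  Rintegral (nu i) (D i) (phi i).
Proof.
move=> lphi; have [M phiM] := lip_bounded L0 (@fcons_compact i) lphi.
rewrite /Rintegral; congr fine; apply/esym.
apply: (integral_transfer mS rhoS (measurable_tuple_coord i) (@push_tuple i) (M := M)) => //.
- by apply: compact_measurable_mx; exact: fcons_compact.
- by move=> x Sx; exact: inD_tuple.
- exact: (lip_measurable L0 (@fcons_compact i) lphi).
Qed.

(** Integrating the residual along [T] compares transport cost and dual value. The
    stability estimate uses this also for potentials of other marginals than
    those of [T]. *)
Lemma integral_residual phi : lipschitz_on_D D L phi ->
  Rintegral rho S (fun x => residual c phi (transport_tuple T x)) =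
  Rintegral rho S (fun x => c (transport_tuple T x))
  - \sum_i Rintegral (nu i) (D i) (phi i).
Proof.
move=> lphi.
have ic := integrable_tuple cost_rel_cont.
have ip i := integrable_tuple (rel_cont_coord i lphi).
have [hs Es] := Rintegral_sum (index_enum _) mS ip.
rewrite /residual RintegralB// Es; congr (_ - _).
by apply: eq_bigr => i _; exact: integral_tuple_coord.
Qed.

End WithMaps.

Lemma monge_costE T : transport_maps S Y rho mu T ->
  monge_cost c S rho T = (Rintegral rho S (fun x => c (transport_tuple T x)))%:E.
Proof.
move=> TT; rewrite /monge_cost /Rintegral fineK//.
exact: (integrable_fin_num mS (integrable_tuple TT cost_rel_cont)).
Qed.

Hypothesis m0 : (0 < m)%N.
Hypothesis muY : forall j, mu j Y = 1%E.

Variable phi : 'I_m.+1 -> 'rV[R]_n -> R.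
Hypothesis cphi : conjugate_potentials c D nu phi.

Let adm x : inD D x -> \sum_i phi i (x i) <= c x.
Proof. by have [[_ +] _ _] := cphi; apply. Qed.

Let lphi : lipschitz_on_D D L phi.
Proof. by have [_ _ cc] := cphi; exact: (conj_lip cL cc). Qed.

Let rcont : rel_cont D (residual c phi).
Proof. exact: (residual_lip L0 cL). Qed.

Hypothesis unique_ae : exists2 N, measurable N /\ rho N = 0%E &
  forall x x', contact D c phi x -> contact D c phi x' ->
    x ord0 = x' ord0 -> ~ N (x ord0) -> x = x'.

(** The almost everywhere unique contact tuple defines the map. Preimages of
    closed sets are contact slices, which gives measurability, and
    [contact_slice0_le] compares its image measures with the marginals on closed
    sets. *)
Lemma contact_transport : exists2 T, transport_maps S Y rho mu T &
  exists2 N, measurable N /\ rho N = 0%E &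
    forall x, S x -> ~ N x -> residual c phi (transport_tuple T x) = 0.
Proof.
have [N [mN N0] uniq] := unique_ae.
pose j0 := Ordinal m0.
have [y0 Yy0] := probability1_nonempty (muY j0).
pose slice j C := contact_slice c D phi (lift ord0 j) C 0.
have mslice j C : closed C -> measurable (slice j C).
  by move=> cC; apply: compact_measurable_mx; apply: contact_slice_compact => //; exact:
    fcons_compact.
have mY : measurable Y by exact: compact_measurable_mx.
have slice_ge j C : closed C -> (mu j C <= rho (slice j C))%E.
  move=> cC; have := contact_slice0_le fcons_compact j cC rcont cphi.
  rewrite /nu /D fcons0 !fconsS; apply: le_trans.
  by rewrite probability_setI1//; exact: closed_measurable_mx.
pose E0 := slice j0 setT.
have mE0 : measurable E0 by apply: mslice; exact: closedT.
have E01 : rho E0 = 1%E.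
  apply/eqP; rewrite eq_le probability_le1//=.
  by rewrite -(probability_setT (mu j0)) slice_ge//; exact: closedT.
have /choice[sel selP] v : exists x, E0 v -> contact D c phi x /\ x ord0 = v.
  have [[x [Dx [_ rx]] xv]|nE] := pselect (E0 v); last by exists (fun=> 0).
  by exists x => _; split.
pose Gd := E0 `&` ~` N.
have mGd : measurable Gd by apply: measurableI => //; exact: measurableC.
(* The good set has full measure; elsewhere any point of Y will do. *)
pose T j v := if v \in Gd then sel v (lift ord0 j) else y0.
have sliceE j C v : Gd v -> slice j C v <-> C (sel v (lift ord0 j)).
  move=> [Ev nNv]; have [cs sv] := selP v Ev; split=> [[x [Dx [Cx rx]] xv]|Cs].
    have -> // : sel v = x by apply: uniq => //; rewrite ?sv.
  by case: cs => Ds rs; exists (sel v).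
have preT j C : T j @^-1` C = (Gd `&` slice j C) `|` (if y0 \in C then ~` Gd else set0).
  apply/seteqP; split => v /=; rewrite /T.
    case: ifPn => [|/negP]; rewrite inE => Gv Cv; last by right; rewrite mem_set.
    by left; split => //; apply/sliceE.
  case=> [[Gv /sliceE Cv]|]; first by rewrite mem_set//; exact: Cv.
  case: ifPn => // /[!inE] Cy Gv.
  by case: ifPn => //; rewrite inE.
have mT j : measurable_fun setT (T j).
  apply: (measurability (@open 'rV[R]_n)) => //.
  move=> _ [B oB <-]; rewrite setTI.
  rewrite (_ : T j @^-1` B = ~` (T j @^-1` (~` B))); last by rewrite preimage_setC setCK.
  apply: measurableC.
  rewrite preT; apply: measurableU.
    by apply: measurableI => //; apply: mslice; exact: open_closedC.
  by case: ifP => // _; exact: measurableC.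
have Gd1 : rho Gd = 1%E.
  rewrite /Gd probability_setI1//; first exact: measurableC.
  by rewrite probability_setC// N0 sube0.
exists T.
  move=> j; split; first exact: measurable_funTS.
    move=> x _; rewrite /T; case: ifPn => // /[!inE] -[Ex _].
    by have [[Ds _] _] := selP x Ex; have := Ds (lift ord0 j); rewrite /D fconsS.
  move=> A mA.
  have mTA B : measurable B -> measurable (T j @^-1` B).
    by move=> mB; rewrite -[X in measurable X]setTI; exact: mT.
  rewrite setIC probability_setI1//; last exact: mTA.
  pose P := measure_function_pushforward__canonical__measure_function_Measure rho (mT j).
  apply/esym; apply: (@measure_eq_closed _ _ (mu j) P) => //.
  - exact: probability_setT.
  - by rewrite /P /= /pushforward preimage_setT probability_setT.
  - move=> C cC; rewrite /P /= /pushforward (le_trans (slice_ge j C cC))//.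
    have mTC : measurable (T j @^-1` C) by apply: mTA; exact: closed_measurable_mx.
    have mSC := mslice j C cC.
    rewrite -(probability_setI1 mGd Gd1 mSC) le_measure ?inE//.
      exact: measurableI.
    by rewrite preT => v [sv Gv]; left.
exists (~` Gd).
  split; first exact: measurableC.
  by rewrite probability_setC// Gd1 subee.
move=> x Sx /contrapT Gx; have [Ex _] := Gx; have [[Ds rs] sx] := selP x Ex.
have -> : transport_tuple T x = sel x.
  apply/funext => i; rewrite /transport_tuple; case: (unliftP ord0 i) => [j|] ->.
    by rewrite fconsS /T mem_set.
  by rewrite fcons0 sx.
by apply/eqP; rewrite eq_le rs subr_ge0 adm.
Qed.

(** Any optimal map costs no more than [contact_transport], whose cost is the dual
    value; so its nonnegative residual has integral 0. *)
Lemma optimal_residual0 T : optimal_maps c S Y rho mu T ->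
  {ae rho, forall x, S x -> residual c phi (transport_tuple T x) = 0}.
Proof.
move=> [TT opt]; have [T' TT' [N [mN N0] r0]] := contact_transport.
have := opt T' TT'; rewrite !monge_costE// lee_fin => le.
have ir := integrable_tuple TT rcont.
have r'0 : Rintegral rho S (fun x => residual c phi (transport_tuple T' x)) = 0.
  rewrite /Rintegral (_ : (\int[_]_(_ in _) _)%E = 0%E)//.
  have ir' := integrable_tuple TT' rcont.
  have mr' : measurable_fun S (EFin \o (fun x => residual c phi (transport_tuple T' x))).
    by have /integrableP[] := ir'.
  transitivity (\int[rho]_(x in S) (cst 0 x))%E; last by rewrite integral0.
  apply: ae_eq_integral => //.
  exists N; split => // x /= /not_implyP[Sx h]; apply: contrapT => nN.
  by apply: h; rewrite r0.
have rle : Rintegral rho S (fun x => residual c phi (transport_tuple T x)) <= 0.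
  by move: r'0; rewrite !integral_residual//; lra.
have rge x : S x -> 0 <= residual c phi (transport_tuple T x).
  by move=> Sx; rewrite subr_ge0; apply: adm; exact: inD_tuple.
have mr : measurable_fun S (EFin \o (fun x => residual c phi (transport_tuple T x))).
  by have /integrableP[] := ir.
have : (\int[rho]_(x in S) `|(residual c phi (transport_tuple T x))%:E| = 0)%E.
  under eq_integral.
    move=> x xS; rewrite gee0_abs; last by rewrite lee_fin rge// -inE.
    over.
  rewrite -(fineK (integrable_fin_num mS ir)); congr EFin.
  apply/eqP; rewrite eq_le; apply/andP; split; first exact: rle.
  by apply: fine_ge0; apply: integral_ge0 => x Sx; rewrite lee_fin rge.
move/(ae_eq_integral_abs rho mS mr); apply: filterS => x /= h Sx.
by have := h Sx => -[].
Qed.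

End TransportIntegrals.

(** * Existence of conjugate potentials *)

Section Existence.
Context {R : realType} {n m : nat}.
Variables (c : ('I_m.+1 -> 'rV[R]_n) -> R) (D : 'I_m.+1 -> set 'rV[R]_n) (L : R).
Variable nu : 'I_m.+1 -> probability 'rV[R]_n R.
Implicit Types phi psi : 'I_m.+1 -> 'rV[R]_n -> R.

Hypothesis L0 : 0 <= L.
Hypothesis cD : forall i, compact (D i).
Hypothesis nuD : forall i, nu i (D i) = 1%E.
Hypothesis cL : forall x y, inD D x -> inD D y ->
  `|c x - c y| <= L * \sum_i `|x i - y i|.

Let mD i : measurable (D i). Proof. exact: compact_measurable_mx. Qed.

Definition admissible psi := forall x, inD D x -> \sum_i psi i (x i) <= c x.

Definition conj_set psi i v := [set (c x - \sum_(j < m.+1 | j != i) psi j (x j))%:E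
  | x in [set x : 'I_m.+1 -> 'rV[R]_n | inD D x /\ x i = v]].

Definition conj_at psi i := forall v, D i v -> (psi i v)%:E = ereal_inf (conj_set psi i v).

Lemma D_point : exists a, inD D a.
Proof.
have /choice[a aP] i : exists v, D i v; last by exists a.
exact: (probability1_nonempty (nuD i)).
Qed.

Lemma conj_set_lb psi i v b : (forall x, inD D x -> x i = v ->
   b <= c x - \sum_(j | j != i) psi j (x j)) -> (b%:E <= ereal_inf (conj_set psi i v))%E.
Proof.
by move=> h; apply/le_ereal_inf_tmp => _ [x [Dx xv] <-]; rewrite lee_fin; exact: h.
Qed.

Lemma admissible_at psi x i : admissible psi -> inD D x ->
  psi i (x i) <= c x - \sum_(j | j != i) psi j (x j).
Proof. by move=> ap Dx; rewrite lerBrDr; have := ap x Dx; rewrite (bigD1 i). Qed.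

Lemma conj_set_fin psi i v : admissible psi -> D i v ->
  exists r : R, ereal_inf (conj_set psi i v) = r%:E.
Proof.
move=> ap Dv; have [a Da] := D_point.
have Dav := inD_upd Da Dv.
have up : (ereal_inf (conj_set psi i v) <=
    (c (upd a i v) - \sum_(j | j != i) psi j (upd a i v j))%:E)%E.
  by apply: ereal_inf_lbound; exists (upd a i v) => //; split => //; exact: upd_id.
have lo : ((psi i v)%:E <= ereal_inf (conj_set psi i v))%E.
  by apply: conj_set_lb => x Dx <-; exact: admissible_at.
exists (fine (ereal_inf (conj_set psi i v))); rewrite fineK//.
rewrite fin_numE; apply/andP; split; apply/eqP => h.
  by rewrite h in lo.
by rewrite h in up.
Qed.

(** The witness replaces the [i]-th potential by the conjugate of the others. *)
Lemma conj_step psi i : admissible psi -> exists psi', [/\ admissible psi',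
  forall l v, D l v -> psi l v <= psi' l v, forall l, l != i -> psi' l = psi l &
  conj_at psi' i].
Proof.
move=> ap.
have /choice[t tP] v : exists r, D i v -> ereal_inf (conj_set psi i v) = r%:E.
  have [Dv|nD] := pselect (D i v); last by exists 0.
  by have [r h] := conj_set_fin ap Dv; exists r.
pose psi' l := if l == i then t else psi l.
have sumE x : \sum_(j | j != i) psi' j (x j) = \sum_(j | j != i) psi j (x j).
  by apply: eq_bigr => j /negbTE ji; rewrite /psi' ji.
have csE v : conj_set psi' i v = conj_set psi i v.
  apply/seteqP; split => _ [x [Dx xv] <-]; exists x => //; by rewrite sumE.
have cat : conj_at psi' i by move=> v Dv; rewrite csE (tP v Dv) /psi' eqxx.
exists psi'; split => //.
- move=> x Dx; rewrite (bigD1 i)//= -lerBrDr sumE -lee_fin cat// csE.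
  by apply: ereal_inf_lbound; exists x.
- move=> l v; case: (eqVneq l i) => [->|/negbTE li] Dv; last by rewrite /psi' li.
  rewrite -lee_fin cat// csE; apply: conj_set_lb => x Dx <-; exact: admissible_at.
- by move=> l /negbTE li; rewrite /psi' li.
Qed.

(** One step at each index suffices: later steps only increase potentials, so an
    earlier one stays below its conjugate by admissibility and above it by
    monotonicity. *)
Lemma conj_round psi : admissible psi -> exists phi, [/\ admissible phi,
  forall l v, D l v -> psi l v <= phi l v & c_conjugate c D phi].
Proof.
move=> ap.
suff h (s : seq 'I_m.+1) : exists phi, [/\ admissible phi,
    forall l v, D l v -> psi l v <= phi l v & forall i, i \in s -> conj_at phi i].
  have [phi [a1 a2 a3]] := h (index_enum _); exists phi; split => // i v Dv.
  by apply: a3 => //; rewrite mem_index_enum.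
elim: s => [|i s [phi [a1 a2 a3]]]; first by exists psi; split.
have [phi' [b1 b2 b3 b4]] := conj_step i a1.
exists phi'; split => // [l v Dv|j]; first by rewrite (le_trans (a2 l v Dv))// b2.
rewrite inE; case: (eqVneq j i) => [->//|ji] /= js v Dv.
apply/eqP; rewrite eq_le; apply/andP; split.
  by apply: conj_set_lb => x Dx <-; exact: admissible_at.
rewrite b3// (a3 j js v Dv); apply/le_ereal_inf_tmp => _ [x [Dx xv] <-].
apply: (@le_trans _ _ (c x - \sum_(l | l != j) phi' l (x l))%:E).
  by apply: ereal_inf_lbound; exists x.
by rewrite lee_fin lerB// ler_sum// => l _; exact: b2.
Qed.

Definition dual_sum phi := \sum_i Rintegral (nu i) (D i) (phi i).

Lemma lip_integrable phi i : lipschitz_on_D D L phi ->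
  (nu i).-integrable (D i) (EFin \o phi i).
Proof.
move=> lphi; have [M phiM] := lip_bounded L0 (@cD i) lphi.
exact: (bounded_integrable _ (mD i) (lip_measurable L0 (@cD i) lphi) phiM).
Qed.

Local Notation tuple_space := (prod_topology (fun _ : ('I_m.+1 * 'rV[R]_n)%type => R)).
Definition curry_tuple (f : tuple_space) : 'I_m.+1 -> 'rV[R]_n -> R := fun i v => f (i, v).

(** Candidates for the maximiser. The bound is imposed at every point, inside the
    domains or not, which puts the set into a product of compact intervals. *)
Definition potential_class (B : R) : set tuple_space := [set f : tuple_space
  | (forall p, f p \in `[- B, B]) /\
  (lipschitz_on_D D L (curry_tuple f) /\ admissible (curry_tuple f))].

Lemma Rintegral_close phi psi i e : lipschitz_on_D D L phi -> lipschitz_on_D D L psi ->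
  (forall v, D i v -> `|phi i v - psi i v| <= e) ->
  `|Rintegral (nu i) (D i) (phi i) - Rintegral (nu i) (D i) (psi i)| <= e.
Proof.
move=> l1 l2 h; have i1 := lip_integrable i l1; have i2 := lip_integrable i l2.
rewrite -RintegralB// (le_trans (le_normr_Rintegral _ _))//; first exact:
  (integrableB (mD i) i1 i2).
rewrite -[leRHS]mulr1 -(_ : fine (nu i (D i)) = 1); last by rewrite nuD.
rewrite -Rintegral_cst//; apply: le_Rintegral => //.
- have i3 : (nu i).-integrable (D i) (EFin \o (fun x => phi i x - psi i x)).
    exact: (integrableB (mD i) i1 i2).
  exact: (integrable_norm i3).
- by apply: finite_measure_integrable_cst.
Qed.

Lemma potential_ext (phi psi : 'I_m.+1 -> 'rV[R]_n -> R) :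
  (forall i v, D i v -> phi i v = psi i v) -> 
  lipschitz_on_D D L phi /\ admissible phi ->
    (lipschitz_on_D D L psi /\ admissible psi) /\ dual_sum psi = dual_sum phi.
Proof.
move=> e [lphi aphi]; split; first split.
- by move=> i v w Dv Dw; rewrite -!e//; exact: lphi.
- move=> x Dx; under eq_bigr do rewrite -e//; exact: aphi.
- apply: eq_bigr => i _; apply: eq_Rintegral => v; rewrite inE => Dv; exact/esym/e.
Qed.

(** Constants with sum 0 are added so that all potentials but the first vanish at
    a reference point. The Lipschitz bound then controls these, and conjugacy
    controls the first one. *)
Lemma normalize_potentials : exists B : R, forall phi, c_conjugate c D phi ->
  exists2 f, potential_class B f & dual_sum (curry_tuple f) = dual_sum phi.
Proof.
have [a Da] := D_point; have [M M0 DM] := D_bounded cD.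
have [Mc Mc0 cM] := rel_cont_bounded cD (rel_cont_lip L0 cL).
pose E := L * (2 * M); have E0 : 0 <= E by rewrite mulr_ge0// mulr_ge0.
exists (Mc + m.+2%:R * E) => phi cphi.
have lphi := conj_lip cL cphi.
have ophi phi' i v w : lipschitz_on_D D L phi' -> D i v -> D i w -> `|phi' i v - phi' i w| <= E.
  move=> l' Dv Dw; rewrite (le_trans (l' _ _ _ Dv Dw))// ler_wpM2l//.
  by rewrite (le_trans (ler_normB _ _))// mulrDl mul1r lerD// (DM i).
pose d i := if i == ord0 then \sum_(j | j != ord0) phi j (a j) else - phi i (a i).
have sumd : \sum_i d i = 0.
  rewrite (bigD1 ord0)//= {1}/d eqxx.
  rewrite [X in _ + X](eq_bigr (fun j => - phi j (a j))); last by move=> j /negbTE j0;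
    rewrite /d j0.
  by rewrite sumrN subrr.
pose phi' i v := phi i v + d i.
have lphi' : lipschitz_on_D D L phi'.
  by move=> i v w Dv Dw; rewrite /phi' opprD addrACA subrr addr0; exact: lphi.
have aphi' : admissible phi'.
  by move=> x Dx; rewrite /phi' big_split /= sumd addr0; exact: (conj_adm cphi Dx).
have cb x : inD D x -> - Mc <= c x <= Mc by move=> /cM; rewrite ler_norml.
have bphi' i v : D i v -> `|phi' i v| <= Mc + m.+2%:R * E.
  move=> Dv; have [i0|i0] := eqVneq i ord0; last first.
    apply: (@le_trans _ _ E); last first.
      by rewrite -[leLHS]add0r lerD// -[leLHS]mul1r ler_wpM2r// ler1n.
    rewrite /phi' /d (negbTE i0); exact: ophi.
  rewrite i0 in Dv *; rewrite ler_norml; apply/andP; split.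
    rewrite /phi' -lerBlDr; apply: (conj_ge cphi Dv) => x Dx xv.
    have /andP[cl _] := cb x Dx; rewrite lerBrDr.
    have : \sum_(j < m.+1 | j != ord0) phi j (x j) <= d ord0 + m.+2%:R * E.
      rewrite /d eqxx -lerBlDl -sumrB.
      apply: (@le_trans _ _ (\sum_(j < m.+1) E)); last first.
        by rewrite sumr_const card_ord -[leLHS]mulr_natl ler_wpM2r// ler_nat.
      rewrite [leRHS](bigID (fun j => j != ord0))/= -[leLHS]addr0 lerD//; last exact: sumr_ge0.
      by apply: ler_sum => j _; rewrite (le_trans (ler_norm _))// ophi.
    lra.
  apply: (@le_trans _ _ Mc); last by rewrite lerDl mulr_ge0.
  have Dav := inD_upd Da Dv.
  have /andP[_ cu] := cb _ Dav; apply: le_trans cu; apply: le_trans (aphi' _ Dav).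
  rewrite (bigD1 ord0)//= upd_id sum_upd_neq big1 ?addr0// => j /negbTE j0.
  by rewrite /phi' /d j0 subrr.
pose f : tuple_space := fun p => if p.2 \in D p.1 then phi' p.1 p.2 else 0.
have fE i v : D i v -> phi' i v = curry_tuple f i v by move=> Dv;
  rewrite /curry_tuple /f /= mem_set.
have [[lf af] Jf] := potential_ext fE (conj lphi' aphi').
exists f.
  split; last by split.
  move=> [i v]; rewrite in_itv /= -ler_norml /f /=; case: ifPn; last first.
    by rewrite normr0 addr_ge0// mulr_ge0.
  by rewrite inE => /bphi'.
rewrite Jf /dual_sum.
transitivity (\sum_i (Rintegral (nu i) (D i) (phi i) + d i)); last first.
  by rewrite big_split /= sumd addr0.
apply: eq_bigr => i _.
rewrite /phi' RintegralD//; first 1 last.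
- exact: lip_integrable.
- by apply: finite_measure_integrable_cst.
have nu1 : fine (nu i (D i)) = 1 by rewrite nuD.
by rewrite Rintegral_cst// [fine _]nu1 mulr1.
Qed.

Lemma near_proj (f : tuple_space) p (e : R) : 0 < e -> \forall f' \near f, `|(f' :
  tuple_space) p - f p| < e.
Proof.
move=> e0.
have h : (fun f' : tuple_space => f' p : R) @ nbhs f --> (f p : R).
  exact: (@proj_continuous _ (fun _ : ('I_m.+1 * 'rV[R]_n)%type => R) p f).
have {}h := (cvgrPdist_lt _ _).1 h e e0.
have FF : Filter (nbhs f) := nbhs_filter f.
by apply: (filterS _ (h FF)) => y; rewrite distrC.
Qed.

Lemma potential_class_compact B : compact (potential_class B).
Proof.
have cbox : compact [set f : tuple_space | forall p, [set` `[(- B : R), B]] (f p)].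
  exact: (@tychonoff _ (fun _ : ('I_m.+1 * 'rV[R]_n)%type => R)
    (fun _ => [set` `[(- B : R), B]]) (fun _ => @segment_compact R (- B) B)).
apply: (subclosed_compact _ cbox) => [f clf|f [bf _] p]; last exact: bf.
have FF : Filter (nbhs f) := nbhs_filter f.
have ev (h : tuple_space -> R) b : (forall e : R, 0 < e -> \forall f' \near f, `|h f' - h f| < e) ->
    (forall f', potential_class B f' -> h f' <= b) -> h f <= b.
  move=> hc hb; apply/ler_addgt0Pr => e e0.
  have [f' [cf' /=]] := clf _ (hc e e0).
  have := hb _ cf'; rewrite ltr_norml => h1 /andP[+ _]; lra.
split; last split.
- move=> p; rewrite in_itv /= lerNl; apply/andP; split.
    apply: (ev (fun f => - f p)) => [e e0|f' [/(_ p) + _]].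
      by apply: (filterS _ (near_proj f p e0)) => f'; rewrite -opprD normrN.
    by rewrite in_itv /= => /andP[+ _]; rewrite lerNl.
  apply: (ev (fun f => f p)) => [e e0|f' [/(_ p) + _]]; first exact: near_proj.
  by rewrite in_itv /= => /andP[_ +].
- move=> i v w Dv Dw; apply: (ev (fun f => `|f (i, v) - f (i, w)|)) => [e e0|f' [_ [+ _]]];
  last exact.
  have e2 : 0 < e / 2 by rewrite divr_gt0.
  apply: (filterS2 _ _ (near_proj f (i, v) e2) (near_proj f (i, w) e2)) => f' h1 h2.
  rewrite (le_lt_trans (ler_dist_dist _ _))// (splitr e).
  rewrite (_ : _ - _ = (f' (i, v) - f (i, v)) - (f' (i, w) - f (i, w))); last by lra.
  by rewrite (le_lt_trans (ler_normB _ _))// ltrD.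
- move=> x Dx; apply: (ev (fun f => \sum_i f (i, x i))) => [e e0|f' [_ [_ +]]]; last exact.
  have e2 : 0 < e / m.+1%:R by rewrite divr_gt0.
  have := @filter_forall _ _ _ (nbhs f) FF (fun i => near_proj f (i, x i) e2).
  apply: filterS => f' h; rewrite -sumrB (le_lt_trans (ler_norm_sum _ _ _))//.
  have -> : e = \sum_(i < m.+1) e / m.+1%:R.
    by rewrite sumr_const card_ord -[RHS]mulr_natr divfK.
  apply: ltr_sum => [|i _]; last exact: h.
  by apply/hasP; exists ord0; rewrite ?mem_index_enum.
Qed.

(** Pointwise closeness on a finite net upgrades to uniform closeness, by the
    common Lipschitz constant. *)
Lemma near_potential_class B (f : tuple_space) (e : R) : potential_class B f -> 0 < e ->
  \forall f' \near f, potential_class B f' -> forall i v, D i v ->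
    `|curry_tuple f' i v - curry_tuple f i v| <= e.
Proof.
move=> cf e0; have L1 : 0 < 2 * L + 1 by rewrite ltr_wpDl// mulr_ge0.
pose d := e / (2 * L + 1); have d0 : 0 < d by rewrite divr_gt0.
have dE : e = (2 * L + 1) * d by rewrite /d mulrC divfK// gt_eqF.
suff h i : \forall f' \near f, potential_class B f' -> forall v, D i v ->
  `|curry_tuple f' i v - curry_tuple f i v| <= e.
  have := @filter_forall _ _ _ (nbhs f) (nbhs_filter f) h.
  apply: filterS => f' h' cf' i v; exact: h'.
have := cD (i := i); rewrite compact_cover => cov.
have [||s sD sc] := cov _ (D i) (fun w => ball w d).
- by move=> w _; exact: ball_open.
- by move=> v Dv; exists v => //; exact: ballxx.
have near_s : \forall f' \near f, forall w, w \in s -> `|(f' : tuple_space) (i, w) - f (i, w)| < d.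
  have := @filter_bigI _ _ s (fun w => [set f' : tuple_space
    | `|f' (i, w) - f (i, w)| < d]) (nbhs f) (nbhs_filter f).
  move=> /(_ (fun w _ => near_proj f (i, w) d0)).
  by apply: filterS => f' h w ws; exact: h.
apply: filterS near_s => f' fs cf' v Dv.
have [w ws vw] := sc v Dv.
have Dw : D i w by have := sD w ws; rewrite inE.
have {}vw : `|v - w| < d by rewrite distrC; move: vw; rewrite -ball_normE.
have [_ [lf' _]] := cf'; have [_ [lf _]] := cf.
have h1 := lf' i v w Dv Dw; have h2 := lf i v w Dv Dw; have h3 := fs w ws.
have -> : curry_tuple f' i v - curry_tuple f i v = (curry_tuple f' i v - curry_tuple f' i w) +
   ((f' (i, w) - f (i, w)) + (curry_tuple f i w - curry_tuple f i v)) by rewrite /curry_tuple; lra.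
rewrite (le_trans (ler_normD _ _))// (le_trans (lerD (lexx _) (ler_normD _ _)))//.
rewrite distrC in h2.
have : L * `|v - w| <= L * d by rewrite ler_wpM2l// ltW.
rewrite dE; lra.
Qed.

Lemma dual_sum_continuous B : {within potential_class B, continuous (fun f : tuple_space =>
  dual_sum (curry_tuple f))}.
Proof.
apply/subspace_continuousP => f cf; apply/cvgrPdist_le => e e0.
have e' : 0 < e / m.+1%:R by rewrite divr_gt0.
have := near_potential_class cf e'.
rewrite nearE /within /= near_simpl; apply: filterS => f' h cf'.
rewrite distrC /dual_sum -sumrB (le_trans (ler_norm_sum _ _ _))//.
have -> : e = \sum_(i < m.+1) e / m.+1%:R.
  by rewrite sumr_const card_ord -[RHS]mulr_natr divfK.
have [_ [lf _]] := cf; have [_ [lf' _]] := cf'.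
by apply: ler_sum => i _; apply: Rintegral_close => // v; exact: h.
Qed.

Lemma dual_sum_le phi psi : (forall i, (nu i).-integrable (D i) (EFin \o phi i)) ->
  lipschitz_on_D D L psi -> (forall i v, D i v -> phi i v <= psi i v) ->
    dual_sum phi <= dual_sum psi.
Proof.
move=> iphi lpsi le; apply: ler_sum => i _; apply: le_Rintegral => //.
- exact: iphi.
- exact: lip_integrable.
- by move=> x Dx; exact: le.
Qed.

(** The dual functional attains its maximum over the compact class; a round of
    conjugations followed by normalisation brings any admissible tuple into the
    class without lowering its value. *)
Lemma conjugate_potentials_exist : exists phi, conjugate_potentials c D nu phi.
Proof.
have [B norm] := normalize_potentials.
have [Mc Mc0 cM] := rel_cont_bounded cD (rel_cont_lip L0 cL).
have a0 : admissible (fun i _ => if i == ord0 then - Mc else 0).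
  move=> x Dx; rewrite (bigD1 ord0)//= big1 ?addr0; last by move=> i /negbTE ->.
  by have := cM x Dx; rewrite ler_norml => /andP[].
have [phi0 [_ _ /norm[f0 cf0 _]]] := conj_round a0.
have [|fm /[!inE] cfm fmax] := @compact_EVT_max tuple_space R _ (potential_class B) _
  (@potential_class_compact B) (@dual_sum_continuous B).
  by exists f0.
have [_ [lfm afm]] := cfm.
have [phi [ap lep cp]] := conj_round afm.
have lphi := conj_lip cL cp.
exists phi; split => //.
  split => //; move=> i; exact: lip_integrable.
move=> psi [ipsi apsi].
rewrite !dual_valueE//; last by move=> i; exact: lip_integrable.
rewrite lee_fin -/(dual_sum psi) -/(dual_sum phi).
have [phi' [_ le' cp']] := conj_round apsi.
have [f' cf' Jf'] := norm _ cp'.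
apply: (le_trans (dual_sum_le ipsi (conj_lip cL cp') le')).
rewrite -Jf' (le_trans (fmax f' _)) ?inE//.
by apply: dual_sum_le => // i; exact: lip_integrable.
Qed.

End Existence.

(** * Ingredients of the stability estimate *)

Section CenteredInequality.
Context {R : realType} {n m : nat}.

Lemma dotB_le (u v : 'rV[R]_n) : dot (u - v) (u - v) <= 2 * dot u u + 2 * dot v v.
Proof. have := dot_ge0 (u + v); rewrite !dotE (dotC v u); lra. Qed.

(** The increments and the centred vectors differ by multiples of the barycenter
    difference whose weights are nonnegative with sum 1, and
    |u - v|^2 <= 2 |u|^2 + 2 |v|^2. *)
Lemma centered_le (lam : 'I_m.+1 -> R) (x x' : 'I_m.+1 -> 'rV[R]_n) kappa tau :
  (0 < m)%N -> (forall i, 0 < lam i) -> \sum_i lam i = 1 -> x ord0 = x' ord0 -> 0 <= kappa ->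
  kappa / 4 * (\sum_(j < m) lam (lift ord0 j) ^+ 2
      * enorm (baryV lam x (lift ord0 j) - baryV lam x' (lift ord0 j)) ^+ 2)
    - (1 + tau + 2 * kappa) / 2 * enorm (baryZ lam x - baryZ lam x') ^+ 2
  <= kappa / 2 * (\sum_(j < m) dot (lam (lift ord0 j) *: (x (lift ord0 j) - x' (lift ord0 j)))
                           (lam (lift ord0 j) *: (x (lift ord0 j) - x' (lift ord0 j))))
     - (1 + tau) / 2 * dot (baryZ lam x - baryZ lam x') (baryZ lam x - baryZ lam x').
Proof.
move=> m0 l0 l1 x0 k0.
set Dl := baryZ lam x - baryZ lam x'.
pose s := \sum_(j < m) lam (lift ord0 j).
have sE : 1 - lam ord0 = s by rewrite -l1 big_ord_recl addrC addKr.
have s0 : 0 < s.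
  by rewrite /s (bigD1 (Ordinal m0))//= ltr_pwDl// sumr_ge0// => j _; exact: ltW.
pose t j := lam (lift ord0 j) / s.
have t01 j : 0 <= t j <= 1.
  rewrite divr_ge0 ?(ltW s0) ?(ltW (l0 _))//= ler_pdivrMr// mul1r /s (bigD1 j)//= lerDl.
  by rewrite sumr_ge0// => l _; exact: ltW.
have t1 : \sum_j t j = 1 by rewrite -mulr_suml divff// gt_eqF.
pose u j := lam (lift ord0 j) *: (x (lift ord0 j) - x' (lift ord0 j)).
have vE j : lam (lift ord0 j) *: (baryV lam x (lift ord0 j) - baryV lam x' (lift ord0 j))
    = u j - t j *: Dl.
  apply/rowP => l; rewrite /baryV /baryM /u /t /Dl sE x0 !mxE; ring.
have term j : lam (lift ord0 j) ^+ 2 *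
     enorm (baryV lam x (lift ord0 j) - baryV lam x' (lift ord0 j)) ^+ 2
     <= 2 * dot (u j) (u j) + 2 * (t j * dot Dl Dl).
  rewrite -(ger0_norm (ltW (l0 (lift ord0 j)))) -exprMn -enormZ sqr_enorm vE.
  rewrite (le_trans (dotB_le _ _))// lerD2l ler_wpM2l// dotZl dotZr mulrA.
  have /andP[ta tb] := t01 j.
  by rewrite ler_wpM2r ?dot_ge0// ler_piMl.
have := ler_sum (index_enum 'I_m) (fun j (_ : true) => term j).
rewrite big_split /= -!mulr_sumr -mulr_suml t1 mul1r sqr_enorm -/Dl => h.
have := ler_wpM2l (divr_ge0 k0 (ler0n _ 4)) h.
have := mulr_ge0 k0 (dot_ge0 Dl); lra.
Qed.

End CenteredInequality.

Section PotentialDifference.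
Context {R : realType} {n m : nat}.
Variables (lam : 'I_m.+1 -> R) (D : 'I_m.+1 -> set 'rV[R]_n).
Variables (G : 'rV[R]_n -> R) (g : 'rV[R]_n -> 'rV[R]_n) (Om : set 'rV[R]_n) (k b d : R).
Variable c : ('I_m.+1 -> 'rV[R]_n) -> R.
Hypotheses (l0 : forall i, 0 < lam i) (l1 : \sum_i lam i = 1).
Hypothesis DOm : forall x, inD D x -> Om (baryZ lam x).
Hypothesis qb : quad_bounds G g Om k b.
Hypothesis cOm : segment_closed Om.
Hypotheses (k0 : 0 <= k) (b0 : 0 <= b).
Hypothesis cE : forall x, c x = \sum_i lam i / 2 * dot (x i) (x i) - G (baryZ lam x).
Hypothesis diamD : forall i v w, D i v -> D i w -> enorm (v - w) <= d.

Lemma baryZ_diam x y : inD D x -> inD D y -> enorm (baryZ lam x - baryZ lam y) <= d.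
Proof.
move=> Dx Dy; rewrite /baryZ -sumrB.
apply: (@le_trans _ _ (\sum_i lam i * enorm (x i - y i))).
  elim/big_rec2 : _ => [|i a v _ h]; first by rewrite enormE dot0l sqrtr0.
  rewrite (le_trans (enormD _ _))// lerD// -scalerBr enormZ ger0_norm//; exact: ltW.
rewrite -[leRHS]mul1r -l1 mulr_suml; apply: ler_sum => i _.
by rewrite ler_wpM2l ?(ltW (l0 i))//; exact: (diamD (Dx i) (Dy i)).
Qed.

(** Both potentials are infima. Comparing them through conjugacy leaves the
    difference of two increments of [G] by the same vector [lam i *: (v - w)],
    hence a mixed difference in which the size of the gradient is irrelevant. *)
Lemma potentials_diff_lip phi phi' i v w :
  c_conjugate c D phi -> c_conjugate c D phi' -> D i v -> D i w ->
  (phi i v - phi' i v) - (phi i w - phi' i w) <= 5 / 4 * b * d * (lam i * enorm (v - w)).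
Proof.
move=> cp cp' Dv Dw; set E := 5 / 4 * b * d * _.
suff : phi i v + phi' i w - phi' i v - E <= phi i w by lra.
apply: (conj_ge cp Dw) => x Dx xw.
have Dxv := inD_upd Dx Dv.
have h1 := conj_le i cp Dxv; rewrite upd_id sum_upd_neq in h1.
suff : phi' i w - (c x - c (upd x i v) + E) <= phi' i v by lra.
apply: (conj_ge cp' Dv) => y Dy yv.
have Dyw := inD_upd Dy Dw.
have h2 := conj_le i cp' Dyw; rewrite upd_id sum_upd_neq in h2.
suff : c (upd y i w) - c y <= c x - c (upd x i v) + E by lra.
pose h := lam i *: (v - w).
have Zx : baryZ lam (upd x i v) = baryZ lam x + h by rewrite baryZ_upd xw.
have Zy : baryZ lam y = baryZ lam (upd y i w) + h.
  by apply/rowP => l; rewrite baryZ_upd yv /h !mxE; ring.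
have hE : enorm h = lam i * enorm (v - w) by rewrite enormZ ger0_norm// ltW.
have hd : enorm h <= d.
  rewrite hE -[leRHS]mul1r ler_pM// ?enorm_ge0 ?(diamD Dv Dw) ?(ltW (l0 i))//.
  by rewrite -l1 (bigD1 i)//= lerDl sumr_ge0// => j _; exact: ltW.
have := @mixed_difference R n Om G g k b d (baryZ lam x) (baryZ lam (upd y i w)) h k0 b0 cOm qb.
rewrite -Zx -Zy => /(_ (DOm Dx) (DOm Dxv) (DOm Dyw) (DOm Dy) hd (baryZ_diam Dyw Dx)).
rewrite !cE hE !(sum_upd (fun l y => lam l / 2 * dot y y)) xw yv /E; lra.
Qed.

End PotentialDifference.

Section WassersteinDuality.
Context {R : realType} {n : nat}.

Lemma measurable_enorm : measurable_fun setT (@enorm R n).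
Proof.
have ms : measurable_fun setT (@Num.sqrt R).
  by apply: continuous_measurable_fun; exact: sqrt_continuous.
rewrite /enorm; apply: (measurableT_comp ms).
apply: measurable_sum => i; apply: measurable_funX; exact: measurable_fun_coord.
Qed.

Lemma measurable_rVB d (X : measurableType d) (A : set X) (f g : X -> 'rV[R]_n) : measurable A ->
  measurable_fun A f -> measurable_fun A g -> measurable_fun A (fun x => f x - g x).
Proof.
move=> mA mf mg; apply: measurable_fun_mx => // i j.
under eq_fun do rewrite !mxE.
by apply: measurable_funB; apply: (measurableT_comp (measurable_fun_coord i j)).
Qed.

(** The easy half of Kantorovich--Rubinstein duality: integrate the Lipschitz
    bound against any coupling. *)
Lemma integral_diff_W1 (mu mu' : probability 'rV[R]_n R) (Y : set 'rV[R]_n) (psi :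
  'rV[R]_n -> R) (M K d : R) :
  measurable Y -> mu Y = 1%E -> mu' Y = 1%E -> measurable_fun Y psi ->
  (forall y, Y y -> `|psi y| <= M) -> (forall v w, Y v -> Y w -> enorm (v - w) <= d) ->
  0 < K -> (forall v w, Y v -> Y w -> psi v - psi w <= K * enorm (v - w)) ->
  ((Rintegral mu Y psi - Rintegral mu' Y psi)%:E <= K%:E * W1 mu mu')%E.
Proof.
move=> mY muY muY' mpsi psiM dY K0 lip.
rewrite -lee_pdivrMl//; apply/le_ereal_inf_tmp => _ [p cp <-].
rewrite lee_pdivrMl//.
pose YY := Y `*` Y.
have mYY : measurable YY by exact: measurableX.
have pf : p (Y `*` setT) = 1%E by have [-> _] := cp _ mY.
have ps : p (setT `*` Y) = 1%E by have [_ ->] := cp _ mY.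
have YYE : YY = (Y `*` setT) `&` (setT `*` Y).
  by rewrite -setXI setIT setTI.
have pYY : p YY = 1%E.
  by rewrite YYE probability_setI1//; exact: measurableX.
have push1 A : measurable A -> p (YY `&` fst @^-1` A) = mu A.
  move=> mA; have [<- _] := cp _ mA.
  rewrite setIC probability_setI1//; last first.
    by rewrite -[X in measurable X]setTI; exact: measurable_fst.
  by congr (p _); apply/seteqP; split => z /=; tauto.
have push2 A : measurable A -> p (YY `&` snd @^-1` A) = mu' A.
  move=> mA; have [_ <-] := cp _ mA.
  rewrite setIC probability_setI1//; last first.
    by rewrite -[X in measurable X]setTI; exact: measurable_snd.
  by congr (p _); apply/seteqP; split => z /=; tauto.
have e1 : (\int[mu]_(y in Y) (psi y)%:E = \int[p]_(z in YY) (psi z.1)%:E)%E.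
  apply: (integral_transfer mYY pYY (measurable_funTS measurable_fst) push1 (M := M)) => //.
  by move=> z [].
have e2 : (\int[mu']_(y in Y) (psi y)%:E = \int[p]_(z in YY) (psi z.2)%:E)%E.
  apply: (integral_transfer mYY pYY (measurable_funTS measurable_snd) push2 (M := M)) => //.
  by move=> z [].
have m1 : measurable_fun YY (fun z => psi z.1).
  apply: (measurable_comp mY _ mpsi) => [_ [z [Yz _] <-]//|].
  by apply: measurable_funTS; exact: measurable_fst.
have m2 : measurable_fun YY (fun z => psi z.2).
  apply: (measurable_comp mY _ mpsi) => [_ [z [_ Yz] <-]//|].
  by apply: measurable_funTS; exact: measurable_snd.
have i1 : p.-integrable YY (EFin \o (fun z => psi z.1)).
  by apply: (bounded_integrable p mYY m1 (M := M)) => z [Yz _]; exact: psiM.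
have i2 : p.-integrable YY (EFin \o (fun z => psi z.2)).
  by apply: (bounded_integrable p mYY m2 (M := M)) => z [_ Yz]; exact: psiM.
have me : measurable_fun setT (fun z : 'rV[R]_n * 'rV[R]_n => enorm (z.1 - z.2)).
  apply: (measurableT_comp measurable_enorm).
  exact: (measurable_rVB measurableT measurable_fst measurable_snd).
have mKe : measurable_fun setT (fun z : 'rV[R]_n * 'rV[R]_n => K * enorm (z.1 - z.2)).
  exact: measurable_funM.
have i3 : p.-integrable YY (EFin \o (fun z => K * enorm (z.1 - z.2))).
  apply: (bounded_integrable p mYY _ (M := K * d)); first exact: measurable_funTS.
  move=> z [Y1 Y2]; rewrite ger0_norm ?mulr_ge0 ?enorm_ge0 ?(ltW K0)//.
  by rewrite ler_wpM2l ?(ltW K0)// dY.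
have -> : (Rintegral mu Y psi - Rintegral mu' Y psi)%:E =
   (\int[p]_(z in YY) (psi z.1 - psi z.2)%:E)%E.
  have -> : Rintegral mu Y psi = Rintegral p YY (fun z => psi z.1) by rewrite /Rintegral e1.
  have -> : Rintegral mu' Y psi = Rintegral p YY (fun z => psi z.2) by rewrite /Rintegral e2.
  rewrite -RintegralB// /Rintegral fineK//.
  exact: (integrable_fin_num mYY (integrableB mYY i1 i2)).
apply: (@le_trans _ _ (\int[p]_(z in YY) (K * enorm (z.1 - z.2))%:E)%E).
  apply: le_integral => //; first exact: (integrableB mYY i1 i2).
  by move=> z /[!inE] -[Y1 Y2]; rewrite lee_fin lip.
rewrite -ge0_integralZl//; last 3 first.
- exact/measurable_EFinP.
- by move=> z _; rewrite lee_fin enorm_ge0.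
- by rewrite lee_fin ltW.
apply: ge0_subset_integral => //; first exact/measurable_EFinP.
by move=> z _; rewrite lee_fin mulr_ge0 ?enorm_ge0 ?(ltW K0).
Qed.

Lemma W1_ge0 (mu mu' : probability 'rV[R]_n R) : (0 <= W1 mu mu')%E.
Proof.
apply/le_ereal_inf_tmp => _ [p _ <-].
by apply: integral_ge0 => z _; rewrite lee_fin enorm_ge0.
Qed.

Lemma L2normE (rho : probability 'rV[R]_n R) (S : set 'rV[R]_n) (g : 'rV[R]_n -> 'rV[R]_n) :
  measurable S -> rho.-integrable S (EFin \o (fun x => dot (g x) (g x))) ->
  L2norm rho S g = (Num.sqrt (Rintegral rho S (fun x => dot (g x) (g x))))%:E.
Proof.
move=> mS ig; rewrite /L2norm unlock.
have -> : (\int[rho]_x (`|((fun x => (enorm (g x))%:E) \_ S) x| `^ 2))%E =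
    (Rintegral rho S (fun x => dot (g x) (g x)))%:E.
  rewrite /Rintegral fineK ?(integrable_fin_num mS ig)// [RHS]integral_mkcond.
  apply: eq_integral => x _; rewrite !patchE; case: ifP => _ /=.
    by rewrite ger0_norm ?enorm_ge0// powR_mulrn ?enorm_ge0// sqr_enorm.
  by rewrite normr0 powR0// pnatr_eq0.
rewrite poweR_EFin powR12_sqrt//; apply: Rintegral_ge0 => x _; exact: dot_ge0.
Qed.

End WassersteinDuality.

Section RealInequalities.
Context {R : realType}.

Lemma sqrtrD_le (a b : R) : 0 <= a -> 0 <= b ->
  Num.sqrt (a + b) <= Num.sqrt a + Num.sqrt b.
Proof.
move=> a0 b0; rewrite -(@ler_pXn2r _ 2)// ?nnegrE ?addr_ge0 ?sqrtr_ge0//.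
rewrite sqrrD !sqr_sqrtr ?addr_ge0//.
have := mulr_ge0 (sqrtr_ge0 a) (sqrtr_ge0 b); lra.
Qed.

Lemma sum_le_sqrt m (a : 'I_m -> R) :
  \sum_j a j <= Num.sqrt (m%:R * \sum_j a j ^+ 2).
Proof.
have := dot_le_enorm (\row_j a j) (const_mx 1 : 'rV[R]_m).
rewrite !enormE /dot.
under eq_bigr do rewrite !mxE mulr1.
under [X in Num.sqrt X * _]eq_bigr do rewrite !mxE -expr2.
under [X in _ * Num.sqrt X]eq_bigr do rewrite !mxE mulr1.
rewrite sumr_const card_ord mulrC -sqrtrM// ?ler0n//.
Qed.

Lemma ediam_ge n (A : set 'rV[R]_n) v w : compact A -> A v -> A w ->
  enorm (v - w) <= ediam A.
Proof.
move=> cA Av Aw; apply: sup_upper_bound; last by exists v => //; exists w.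
split; first by exists (enorm (v - w)); exists v => //; exists w.
have [N [Nr NP]] := compact_bounded cA.
have bd u : A u -> `|u| <= `|N| + 1.
  by move=> Au; apply: (NP _ _ u Au); rewrite ltr_pwDr//; exact: ler_norm.
exists (n%:R * (2 * (`|N| + 1))) => _ [u Au [u' Au' <-]].
rewrite (le_trans (enorm_le_norm _))// ler_wpM2l//.
by rewrite (le_trans (ler_normB _ _))// mulrDl mul1r lerD ?bd.
Qed.

Lemma dot_integrable n (rho : probability 'rV[R]_n R) (S : set 'rV[R]_n)
    (h : 'rV[R]_n -> 'rV[R]_n) (d : R) :
  measurable S -> measurable_fun S h -> (forall x, S x -> enorm (h x) <= d) ->
  rho.-integrable S (EFin \o (fun x => dot (h x) (h x))).
Proof.
move=> mS mh hd; apply: (bounded_integrable rho mS _ (M := d ^+ 2)).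
  rewrite /dot; apply: measurable_sum => i.
  by apply: measurable_funM; apply: (measurableT_comp (measurable_fun_coord 0 i)).
move=> x Sx; rewrite ger0_norm ?dot_ge0// -sqr_enorm lerXn2r ?nnegrE ?enorm_ge0//; last exact: hd.
by rewrite (le_trans (enorm_ge0 (h x)))// hd.
Qed.

End RealInequalities.

(** * Assembly *)

Section Main.
Context {R : realType} {n m : nat}.
Variables (lam : 'I_m.+1 -> R) (S Y U : set 'rV[R]_n).
Variables (F : 'rV[R]_n -> R) (kappa tau : R).
Variable rho : probability 'rV[R]_n R.
Hypothesis m0 : (0 < m)%N.
Hypotheses (l0 : forall i, 0 < lam i) (l1 : \sum_i lam i = 1).
Hypotheses (cS : compact S) (cY : compact Y).
Hypotheses (oU : open U) (hU : closure (convex_hull (S `|` Y)) `<=` U).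
Hypotheses (C2F : C2_on U F) (k01 : 0 < kappa <= 1) (tau0 : 0 <= tau).
Hypothesis hess : hessian_between U F (- tau) (1 - kappa).
Hypotheses (rhoS : rho S = 1%E) (rholeb : rho `<< @lebesgue_rV R n).

Let Om := convex_hull (S `|` Y).
Let G (z : 'rV[R]_n) := dot z z / 2 - F z.
Let g (z : 'rV[R]_n) := z - grad F z.
Let D := fcons S (fun _ : 'I_m => Y).
Let c := cost lam F.

Let OmU : Om `<=` U.
Proof. by move=> z Oz; apply: hU; exact: subset_closure. Qed.

Let cOm : segment_closed Om. Proof. exact: convex_hull_segment_closed. Qed.

Let D_sub i v : D i v -> (S `|` Y) v.
Proof.
by rewrite /D; case: (unliftP ord0 i) => [j|] ->; rewrite ?fconsS ?fcons0; [right|left].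
Qed.

Let DOm x : inD D x -> Om (baryZ lam x).
Proof.
move=> Dx; apply: baryZ_segment_closed => // i.
by apply: sub_convex_hull; exact: (D_sub (Dx i)).
Qed.

Let qb : quad_bounds G g Om kappa (1 + tau).
Proof. exact: C2_quad_bounds oU cOm OmU C2F hess. Qed.

Let gcont i z : Om z -> {for z, continuous (fun z => g z 0 i)}.
Proof.
move=> Oz; have -> : (fun z => g z 0 i) = (fun z => z 0 i - partial i F z).
  by apply/funext => y; rewrite /g !mxE.
apply: (@continuousB _ _ _ (fun z : 'rV[R]_n => z 0 i)); first exact: coord_continuous.
by have [_ /(_ i z (OmU Oz))[_ +] _] := C2F.
Qed.

Let cE x : c x = \sum_i lam i / 2 * dot (x i) (x i) - G (baryZ lam x).
Proof. exact: cost_quadratic. Qed.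

Let kappa0 : 0 < kappa. Proof. by have /andP[] := k01. Qed.

Let cD i : compact (D i). Proof. exact: fcons_compact. Qed.

Let mS : measurable S. Proof. exact: compact_measurable_mx. Qed.
Let mY : measurable Y. Proof. exact: compact_measurable_mx. Qed.

Let cL := cost_lip l0 l1 cD DOm qb (ltW kappa0) gcont cE.

Section OneFamily.
Variable mu : 'I_m -> probability 'rV[R]_n R.
Hypothesis muY : forall j, mu j Y = 1%E.

Let nu := fcons rho mu.

Lemma nuD1 i : nu i (D i) = 1%E.
Proof. by rewrite /nu /D; case: (unliftP ord0 i) => [j|] ->; rewrite ?fconsS ?fcons0. Qed.

Lemma potentials_exist : exists phi, conjugate_potentials c D nu phi.
Proof. by have [L L0 lip] := cL; exact: (conjugate_potentials_exist L0 cD nuD1 lip). Qed.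

Variable phi : 'I_m.+1 -> 'rV[R]_n -> R.
Hypothesis cphi : conjugate_potentials c D nu phi.
Variable T : 'I_m -> 'rV[R]_n -> 'rV[R]_n.
Hypothesis optT : optimal_maps c S Y rho mu T.

Lemma optimal_contact_ae :
  {ae rho, forall x, S x -> residual c phi (transport_tuple T x) = 0}.
Proof.
have [L L0 lip] := cL.
have [[_ adm] _ cc] := cphi.
have rc := residual_lip L0 lip (conj_lip lip cc).
have uniq := contact_unique_ae l0 l1 cD DOm qb kappa0 gcont cE adm rc rholeb.
exact: (optimal_residual0 cS cY rhoS L0 lip m0 muY cphi uniq optT).
Qed.

Lemma residual_quadratic_ae : {ae rho, forall x1, S x1 ->
  forall x, inD D x -> x ord0 = x1 ->
  kappa / 2 * (\sum_(j < m) dot (lam (lift ord0 j) *: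
    (x (lift ord0 j) - transport_tuple T x1 (lift ord0 j)))
                           (lam (lift ord0 j) *: (x (lift ord0 j) - transport_tuple T x1
                             (lift ord0 j))))
  - (1 + tau) / 2 * dot (baryZ lam x - baryZ lam (transport_tuple T x1)) (baryZ lam x -
    baryZ lam (transport_tuple T x1))
  <= residual c phi x}.
Proof.
have [TT _] := optT; have [[_ adm] _ _] := cphi.
move: optimal_contact_ae; apply: filterS => x1 r0 Sx1 x Dx xx1.
apply: (residual_ge_swaps cE DOm qb adm Dx (inD_tuple TT Sx1)) => //; last exact: r0.
by rewrite xx1 /transport_tuple fcons0.
Qed.

End OneFamily.

Let d := ediam (S `|` Y).

Let diamD i v w : D i v -> D i w -> enorm (v - w) <= d.
Proof. by move=> /D_sub Dv /D_sub Dw; apply: ediam_ge => //; exact: compactU. Qed.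

Let dY v w : Y v -> Y w -> enorm (v - w) <= d.
Proof. by move=> Yv Yw; apply: ediam_ge; [exact: compactU|right|right]. Qed.

Lemma diam_ge0 : 0 <= d.
Proof.
have [v Sv] := probability1_nonempty rhoS.
rewrite (le_trans (enorm_ge0 (v - v)))//.
by apply: ediam_ge; [exact: compactU|left|left].
Qed.

Section TwoFamilies.
Variables (mu mu' : 'I_m -> probability 'rV[R]_n R) (T T' : 'I_m -> 'rV[R]_n -> 'rV[R]_n).
Hypotheses (TT : transport_maps S Y rho mu T) (TT' : transport_maps S Y rho mu' T').

Lemma integrable_map_diff j :
  rho.-integrable S (EFin \o (fun x => dot (T j x - T' j x) (T j x - T' j x))).
Proof.
have [mT TY _] := TT j; have [mT' TY' _] := TT' j.
apply: (dot_integrable rho mS (h := fun x => T j x - T' j x) (d := d)).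
  exact: measurable_rVB.
by move=> x Sx; apply: dY; [exact: TY|exact: TY'].
Qed.

Lemma measurable_baryZ_tuple (V : 'I_m -> 'rV[R]_n -> 'rV[R]_n) nu : transport_maps S Y rho nu V ->
  measurable_fun S (fun x => baryZ lam (transport_tuple V x)).
Proof.
move=> VV; apply: measurable_fun_mx => // i j.
under eq_fun do rewrite /baryZ summxE.
apply: measurable_sum => l.
under eq_fun do rewrite mxE.
apply: measurable_funM => //; apply: (measurableT_comp (measurable_fun_coord i j)).
exact: (measurable_tuple_coord VV).
Qed.

Definition baryZ_diff x :=
  baryZ lam (transport_tuple T x) - baryZ lam (transport_tuple T' x).

Lemma integrable_baryZ_diff :
  rho.-integrable S (EFin \o (fun x => dot (baryZ_diff x) (baryZ_diff x))).
Proof.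
apply: (dot_integrable rho mS (h := baryZ_diff) (d := d)).
  apply: measurable_rVB => //; first exact: (measurable_baryZ_tuple TT).
  exact: (measurable_baryZ_tuple TT').
move=> x Sx; apply: (baryZ_diam l0 l1 (D := D)); first exact: diamD.
  exact: (inD_tuple TT).
exact: (inD_tuple TT').
Qed.

End TwoFamilies.

(** Both optimal tuples have residual 0 for their own potentials. So the integrals of
    the residuals with exchanged potentials add up to the differences of potentials
    integrated against the differences of marginals. *)
Lemma stability_squares (mu mu' : 'I_m -> probability 'rV[R]_n R)
    (T T' : 'I_m -> 'rV[R]_n -> 'rV[R]_n) :
  (forall j, mu j Y = 1%E) -> (forall j, mu' j Y = 1%E) ->
  optimal_maps c S Y rho mu T -> optimal_maps c S Y rho mu' T' ->
  (((kappa / 2 * \sum_(j < m) lam (lift ord0 j) ^+ 2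
        * Rintegral rho S (fun x => dot (T j x - T' j x) (T j x - T' j x)))
    - (1 + tau) / 2 * Rintegral rho S (fun x =>
        dot (baryZ_diff T T' x) (baryZ_diff T T' x)))%:E
   <= (5 / 4 * (1 + tau) * (d + 1))%:E
      * \sum_(j < m) (lam (lift ord0 j))%:E * W1 (mu j) (mu' j))%E.
Proof.
move=> muY muY' optT optT'.
have [phi cphi] := potentials_exist muY; have [phi' cphi'] := potentials_exist muY'.
have [TT _] := optT; have [TT' _] := optT'.
have [L L0 lip] := cL.
have [[_ adm] _ cc] := cphi; have [[_ adm'] _ cc'] := cphi'.
have lphi := conj_lip lip cc; have lphi' := conj_lip lip cc'.
have b0 : 0 <= 1 + tau by rewrite addr_ge0.
have r0 := optimal_contact_ae muY cphi optT.
have r0' := optimal_contact_ae muY' cphi' optT'.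
have rq := residual_quadratic_ae muY cphi optT.
have rcont := residual_lip L0 lip lphi; have rcont' := residual_lip L0 lip lphi'.
have ae0 (h : 'rV[R]_n -> R) : {ae rho, forall x, S x -> h x = 0} -> 
    rho.-integrable S (EFin \o h) -> Rintegral rho S h = 0.
  move=> h0 ih; apply/eqP; rewrite eq_le; apply/andP; split.
    rewrite -oppr_ge0 -mulN1r -RintegralZl//; apply: Rintegral_ae_ge0 => //.
      exact: (integrableZl mS (-1) ih).
    by apply: filterS h0 => x hx Sx; rewrite hx// mulr0.
  by apply: Rintegral_ae_ge0 => //; apply: filterS h0 => x hx Sx; rewrite hx.
have z1 := ae0 _ r0 (integrable_tuple cS cY TT rcont).
have z2 := ae0 _ r0' (integrable_tuple cS cY TT' rcont').
have z3 : 0 <= Rintegral rho S (fun x => residual c phi' (transport_tuple T x)).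
  by apply: Rintegral_ge0 => x Sx; rewrite subr_ge0; apply: adm'; exact: inD_tuple.
rewrite (integral_residual cS cY rhoS L0 lip TT lphi) in z1.
rewrite (integral_residual cS cY rhoS L0 lip TT' lphi') in z2.
rewrite (integral_residual cS cY rhoS L0 lip TT lphi') in z3.
have iA j := integrable_map_diff TT TT' j.
have iB := integrable_baryZ_diff TT TT'.
pose ZZ := baryZ_diff T T'.
set A := \sum_(j < m) _; set B := Rintegral rho S _.
have iA2 j : rho.-integrable S (EFin \o (fun x =>
  lam (lift ord0 j) ^+ 2 * dot (T j x - T' j x) (T j x - T' j x))).
  exact: (integrableZl mS _ (iA j)).
have [iAs As] := Rintegral_sum (index_enum 'I_m) mS iA2.
have AE : A = Rintegral rho S (fun x =>
  \sum_(j < m) lam (lift ord0 j) ^+ 2 * dot (T j x - T' j x) (T j x - T' j x)).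
  by rewrite As; apply: eq_bigr => j _; rewrite RintegralZl.
have ir := integrable_tuple cS cY TT' rcont.
have low : kappa / 2 * A - (1 + tau) / 2 * B <=
    Rintegral rho S (fun x => residual c phi (transport_tuple T' x)).
  have i1 : rho.-integrable S (EFin \o (fun x =>
    kappa / 2 * \sum_(j < m) lam (lift ord0 j) ^+ 2 * dot (T j x - T' j x) (T j x - T' j x))).
    exact: (integrableZl mS _ iAs).
  have i2 : rho.-integrable S (EFin \o (fun x => (1 + tau) / 2 * dot (ZZ x) (ZZ x))).
    exact: (integrableZl mS _ iB).
  rewrite AE -RintegralZl// -[(1 + tau) / 2 * B]RintegralZl//.
  rewrite -RintegralB// -subr_ge0 -RintegralB//; last exact: (integrableB mS i1 i2).
  apply: Rintegral_ae_ge0 => //; first exact: (integrableB mS ir (integrableB mS i1 i2)).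
  apply: filterS rq => x rx Sx; rewrite subr_ge0.
  have := rx Sx _ (inD_tuple TT' Sx) _; rewrite /transport_tuple fcons0 => /(_ erefl).
  apply: le_trans; rewrite lerD//.
    rewrite ler_wpM2l ?divr_ge0 ?(ltW kappa0)//; apply: ler_sum => j _.
    by rewrite !fconsS dotZl dotZr mulrA -expr2 -[T j x - _]opprB dotNl dotNr opprK.
  by rewrite lerN2 -/(transport_tuple T x) -/(transport_tuple T' x) /ZZ /baryZ_diff -[X in
    dot X X]opprB dotNl dotNr opprK.
rewrite (integral_residual cS cY rhoS L0 lip TT' lphi) in low.
pose psi i v := phi i v - phi' i v.
have ip (mm : 'I_m -> probability 'rV[R]_n R) i : (forall j, mm j Y = 1%E) ->
  (fcons rho mm i).-integrable (D i) (EFin \o phi i).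
  by move=> mmY; apply: (lip_integrable _ L0 cD); exact: lphi.
have ip' (mm : 'I_m -> probability 'rV[R]_n R) i : (forall j, mm j Y = 1%E) ->
  (fcons rho mm i).-integrable (D i) (EFin \o phi' i).
  by move=> mmY; apply: (lip_integrable _ L0 cD); exact: lphi'.
have mD i : measurable (D i) by apply: compact_measurable_mx; exact: cD.
(* What remains of the dual values once both optimality conditions are used; the
   terms of the first marginal, common to both problems, cancel. *)
pose dl (j : 'I_m) := Rintegral (mu j) Y (psi (lift ord0 j)) - Rintegral (mu' j) Y (psi
  (lift ord0 j)).
have up : kappa / 2 * A - (1 + tau) / 2 * B <= \sum_j dl j.
  apply: (le_trans low).
  have -> : \sum_j dl j = \sum_(i < m.+1)
     ((Rintegral (fcons rho mu i) (D i) (phi i) - Rintegral (fcons rho mu i) (D i) (phi' i))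
    - (Rintegral (fcons rho mu' i) (D i) (phi i) - Rintegral (fcons rho mu' i) (D i) (phi' i))).
    rewrite big_ord_recl !fcons0 subrr add0r; apply: eq_bigr => j _.
    have := ip mu (lift ord0 j) muY; have := ip' mu (lift ord0 j) muY.
    have := ip mu' (lift ord0 j) muY'; have := ip' mu' (lift ord0 j) muY'.
    by rewrite /dl /psi /D !fconsS => h1 h2 h3 h4; rewrite !RintegralB.
  rewrite !sumrB; lra.
apply: (@le_trans _ _ (\sum_j dl j)%:E); first by rewrite lee_fin.
rewrite -sumEFin ge0_sume_distrr; last first.
  by move=> j _; rewrite mule_ge0 ?W1_ge0// lee_fin ltW.
apply: lee_sum => j _; rewrite muleA -EFinM.
have d0 := diam_ge0.
have Dj v : Y v -> D (lift ord0 j) v by rewrite /D fconsS.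
have [M1 M1P] := lip_bounded L0 (@cD (lift ord0 j)) lphi.
have [M2 M2P] := lip_bounded L0 (@cD (lift ord0 j)) lphi'.
have := lip_measurable L0 (@cD (lift ord0 j)) lphi.
have := lip_measurable L0 (@cD (lift ord0 j)) lphi'.
rewrite /D fconsS => mp' mp.
apply: (@integral_diff_W1 _ _ (mu j) (mu' j) Y (psi (lift ord0 j)) (M1 + M2) _ d) => //.
- exact: measurable_funB.
- move=> y Yy; rewrite (le_trans (ler_normB _ _))// lerD//; [exact/M1P/Dj|exact/M2P/Dj].
- have t1 : 0 < 1 + tau by rewrite ltr_pwDl.
  have d1 : 0 < d + 1 by rewrite ltr_wpDl.
  by rewrite !mulr_gt0 ?l0// invr_gt0.
- move=> v w Yv Yw; rewrite -[leRHS]mulrA.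
  (* The diameter is enlarged by 1 so that the Lipschitz constant is positive even
     if it vanishes. *)
  have dD i v' w' : D i v' -> D i w' -> enorm (v' - w') <= d + 1.
    by move=> Dv Dw; rewrite (le_trans (diamD Dv Dw))// lerDl.
  exact: (potentials_diff_lip l0 l1 DOm qb cOm (ltW kappa0) b0 cE dD cc cc' (Dj v Yv) (Dj w Yw)).
Qed.

(** Square roots of [stability_squares]; the factor [m.+1] comes from bounding a
    sum by the square root of the sum of squares. *)
Lemma stability_L2 (mu mu' : 'I_m -> probability 'rV[R]_n R)
    (T T' : 'I_m -> 'rV[R]_n -> 'rV[R]_n) :
  (forall j, mu j Y = 1%E) -> (forall j, mu' j Y = 1%E) ->
  optimal_maps c S Y rho mu T -> optimal_maps c S Y rho mu' T' ->
  (\sum_(j < m) (lam (lift ord0 j))%:E * L2norm rho S (fun x => (T j x - T' j x)%R)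
   <= (Num.sqrt (2 * m.+1%:R * (5 / 4 * (1 + tau) * (d + 1)) / kappa)
       + Num.sqrt (m.+1%:R * (1 + tau) / kappa))%:E
      * ((\sum_(j < m) (lam (lift ord0 j))%:E * W1 (mu j) (mu' j)) `^ 2^-1
         + L2norm rho S (baryZ_diff T T')))%E.
Proof.
move=> muY muY' optT optT'.
have sq0 := stability_squares muY muY' optT optT'.
have [TT _] := optT; have [TT' _] := optT'.
have iA j := integrable_map_diff TT TT' j.
have iB := integrable_baryZ_diff TT TT'.
rewrite (L2normE mS iB).
set K := 5 / 4 * (1 + tau) * (d + 1).
set B := Rintegral rho S _; set N : R := m.+1%:R.
pose A j := Rintegral rho S (fun x => dot (T j x - T' j x) (T j x - T' j x)).
have LE j : L2norm rho S (fun x => T j x - T' j x) = (Num.sqrt (A j))%:E.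
  exact: (L2normE mS (g := fun x => T j x - T' j x) (iA j)).
under eq_bigr do rewrite LE -EFinM.
rewrite sumEFin; move: sq0; rewrite -/K -/B.
set w := (\sum_(j < m) _)%E.
have w0 : (0 <= w)%E.
  by apply: sume_ge0 => j _; rewrite mule_ge0 ?W1_ge0// lee_fin ltW.
have tau1 : 0 < 1 + tau by rewrite ltr_pwDl.
have K0 : 0 < K by rewrite !mulr_gt0 ?invr_gt0// ltr_wpDl// diam_ge0.
have N0 : 0 < N by rewrite ltr0n.
have A0 j : 0 <= A j by apply: Rintegral_ge0 => x _; exact: dot_ge0.
have B0 : 0 <= B by apply: Rintegral_ge0 => x _; exact: dot_ge0.
set C1 := Num.sqrt (2 * _ * _ / _); set C2 := Num.sqrt (_ / kappa).
have C10 : 0 <= C1 by exact: sqrtr_ge0.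
have C20 : 0 < C2 by rewrite sqrtr_gt0 divr_gt0// mulr_gt0.
case: w w0 => [r|_|//]; last first.
  by move=> _; rewrite poweRyr ?invr_eq0 ?pnatr_eq0// addye// gt0_muley ?leey// lte_fin ltr_wpDl.
rewrite lee_fin => r0; rewrite -EFinM lee_fin => sq.
rewrite poweR_EFin powR12_sqrt// -EFinD -EFinM lee_fin.
set Q := \sum_(j < m) lam (lift ord0 j) ^+ 2 * A j in sq.
have Qle : Q <= (2 * K * r + (1 + tau) * B) / kappa.
  by rewrite ler_pdivlMr//; lra.
rewrite (le_trans (sum_le_sqrt _))//.
have -> : \sum_(j < m) (lam (lift ord0 j) * Num.sqrt (A j)) ^+ 2 = Q.
  by apply: eq_bigr => j _; rewrite exprMn sqr_sqrtr.
have Q0 : 0 <= Q by apply: sumr_ge0 => j _; rewrite mulr_ge0 ?sqr_ge0.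
apply: (@le_trans _ _ (Num.sqrt (2 * N * K / kappa * r + N * (1 + tau) / kappa * B))).
  rewrite ler_wsqrtr//.
  apply: (@le_trans _ _ (N * Q)); first by rewrite ler_wpM2r// ler_nat.
  have := ler_wpM2l (ltW N0) Qle; move/le_trans; apply.
  by rewrite le_eqVlt; apply/orP; left; apply/eqP; field; rewrite gt_eqF.
have k1 : 0 <= 2 * N * K / kappa by apply/ltW/divr_gt0 => //; apply: mulr_gt0 => //; apply:
  mulr_gt0.
have k2 : 0 <= N * (1 + tau) / kappa by apply/ltW/divr_gt0 => //; apply: mulr_gt0.
apply: (le_trans (sqrtrD_le (mulr_ge0 k1 r0) (mulr_ge0 k2 B0))).
rewrite (sqrtrM _ k1) (sqrtrM _ k2) -/C1 -/C2.
have := sqrtr_ge0 r; have := sqrtr_ge0 B.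
move: (Num.sqrt r) (Num.sqrt B) => x y y0 x0.
have := mulr_ge0 C10 y0; have := mulr_ge0 (ltW C20) x0; lra.
Qed.

End Main.

Theorem proposition4p1 (R : realType) :
  exists C : nat -> R -> R -> R -> R,
  forall (n m : nat) (lam : 'I_m.+1 -> R) (S Y U : set 'rV[R]_n)
    (F : 'rV[R]_n -> R) (kappa tau : R)
    (rho : probability 'rV[R]_n R) (mu : 'I_m -> probability 'rV[R]_n R)
    (T : 'I_m -> 'rV[R]_n -> 'rV[R]_n),
  (3 <= m.+1)%N ->
  (forall i, 0 < lam i) -> \sum_i lam i = 1 ->
  compact S -> compact Y ->
  open U -> closure (convex_hull (S `|` Y)) `<=` U ->
  C2_on U F -> 0 < kappa <= 1 -> 0 <= tau ->
  hessian_between U F (- tau) (1 - kappa) ->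
  rho S = 1%E -> rho `<< @lebesgue_rV R n -> (forall j, mu j Y = 1%E) ->
  optimal_maps (cost lam F) S Y rho mu T ->
  (forall phi : 'I_m.+1 -> 'rV[R]_n -> R,
    conjugate_potentials (cost lam F) (fcons S (fun=> Y)) (fcons rho mu) phi ->
    {ae rho, forall x1, S x1 ->
      forall x' : 'I_m -> 'rV[R]_n, (forall j, Y (x' j)) ->
      let x := fcons x1 x' in
      let xF := transport_tuple T x1 in
      residual (cost lam F) phi x >=
        kappa / 4 * (\sum_(j < m) lam (lift ord0 j) ^+ 2
          * enorm (baryV lam x (lift ord0 j) - baryV lam xF (lift ord0 j)) ^+ 2)
        - (1 + tau + 2 * kappa) / 2 * enorm (baryZ lam x - baryZ lam xF) ^+ 2})
  /\
  (forall (mu' : 'I_m -> probability 'rV[R]_n R)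
      (T' : 'I_m -> 'rV[R]_n -> 'rV[R]_n),
    (forall j, mu' j Y = 1%E) ->
    optimal_maps (cost lam F) S Y rho mu' T' ->
    (\sum_(j < m) (lam (lift ord0 j))%:E
        * L2norm rho S (fun x => (T j x - T' j x)%R)
     <= (C m.+1 (ediam (S `|` Y)) kappa tau)%:E
        * ((\sum_(j < m) (lam (lift ord0 j))%:E * W1 (mu j) (mu' j)) `^ 2^-1
           + L2norm rho S
               (fun x => (baryZ lam (transport_tuple T x)
                          - baryZ lam (transport_tuple T' x))%R)))%E).
Proof.
exists (fun N d kappa tau => Num.sqrt (2 * N%:R * (5 / 4 * (1 + tau) * (d + 1)) / kappa)
  + Num.sqrt (N%:R * (1 + tau) / kappa)).
move=> n m lam S Y U F kappa tau rho mu T m3 l0 l1 cS cY oU hU C2F k01 tau0 hess.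
move=> rhoS rholeb muY optT.
have m0 : (0 < m)%N by apply: leq_trans (_ : 2 <= m)%N.
split=> [phi cphi|mu' T' muY' optT']; last first.
  exact: (stability_L2 m0 l0 l1 cS cY oU hU C2F k01 tau0 hess rhoS rholeb muY muY' optT optT').
move: (residual_quadratic_ae m0 l0 l1 cS cY oU hU C2F k01 hess rhoS rholeb muY cphi optT).
apply: filterS => x1 h Sx1 x' Yx' /=.
have Dx : inD (fcons S (fun=> Y)) (fcons x1 x').
  by move=> i; case: (unliftP ord0 i) => [j|] ->; rewrite ?fconsS ?fcons0.
apply: le_trans (h Sx1 _ Dx (fcons0 _ _)).
by apply: centered_le => //; [rewrite /transport_tuple !fcons0|have /andP[/ltW] := k01].
Qed.
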